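(* Assume the following statement (the almost stability theorem for pmp equivalence relations): for every pmp equivalence relation $R$ and every quasi-periodic countable $R$-set $E$, any $R$-stable almost equality class over $E$ is the vertex set of an $R$-tree with quasi-periodic edge set. Then every pmp equivalence relation admitting a finite index treeable subrelation is treeable.
   Context: All sets, maps, equivalence relations and actions are Borel. A Borel equivalence relation $R\subset X\times X$ on a standard Borel space $X$ with a probability measure $\mu$ is probability measure preserving (pmp) if $\int_X|K^x|\,d\mu(x)=\int_X|K_y|\,d\mu(y)$ for every Borel $K\subset R$, where $K^x$ is the set of elements of $K$ with first coordinate $x$ and $K_y$ the set of elements of $K$ with second coordinate $y$. For pmp equivalence relations, negligible sets are discarded as required (all statements are understood up to null sets). $R$ is viewed as a groupoid: $(x,y)\in R$ is an arrow from $y$ to $x$, with $(x,y)(y,z)=(x,z)$. R-spaces. An $R$-space $Y$ is a field $(Y^x)_{x\in X}$ of standard Borel spaces with bijections $Y^y\to Y^x$, $v\mapsto (x,y)v$, for $(x,y)\in R$, functorial in $(x,y)$, such that the total space $Y=\bigsqcup_x Y^x$ carries a standard Borel structure for which the projection to $X$, the identification of each $Y^x$ with the fibre over $x$, and the action map are Borel. If all $Y^x$ are countable sets, $Y$ is a countable $R$-set. The orbit of $v\in Y^y$ is $\{(x,y)v:(x,y)\in R\}$. A fundamental domain is a Borel subset of $Y$ meeting every orbit exactly once; $Y$ is quasi-periodic if it admits one. Trees. A countable graph is a pair of countable sets (vertices, edges) with source and range maps from edges to vertices; a tree is a connected acyclic countable graph. An $R$-tree $T$ is a Borel field of trees $(T^x)_{x\in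 X}$ on which $R$ acts by graph isomorphisms, so that the vertex set $VT=(VT^x)_x$ and the edge set $ET=(ET^x)_x$ are countable $R$-sets. An $R$-space $V$ is the vertex set of an $R$-tree $T$ if $VT=V$ as $R$-spaces. Almost equality. For a countable set $F$, $(F,\mathbb Z_2)$ denotes the power set of $F$ (functions $F\to\mathbb Z/2\mathbb Z$); two elements are almost equal if they differ at finitely many points, and the equivalence classes are the almost equality classes. For a countable $R$-set $E$, $(E,\mathbb Z_2)$ is the Borel field $x\mapsto(E^x,\mathbb Z_2)$ with the $R$-action $((x,y)u)(e)=u((y,x)e)$. An $R$-stable almost equality class over $E$ is a Borel subfield $V\subset(E,\mathbb Z_2)$ such that each $V^x$ is an almost equality class of $(E^x,\mathbb Z_2)$ and $(x,y)V^y=V^x$ for all $(x,y)\in R$. Treeability and index. A treeing of an equivalence relation $S$ on $X$ is a Borel subset $K\subset S$ such that the connected components of the graph with vertex set $X$ and edge set $K$ are the $S$-classes and the induced graph on every class is a tree; $S$ is treeable if it admits a treeing. A subrelation $S\subset R$ has index $n$ if there are Borel maps $f_1,\dots,f_n:X\to X$ such that for every $x$ the $S$-classes $S(f_1(x)),\dots,S(f_n(x))$ form a partition of the $R$-class of $x$ into $n$ classes; $S$ has finite index if $X$ is a finite disjoint union of $R$-invariant Borel sets on each of which $S$ has some finite index. *)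

(* Defs.v *)
From HB Require Import structures.
From mathcomp Require Import all_boot all_order all_algebra.
From mathcomp Require Import all_classical all_reals all_analysis.

Set Implicit Arguments.
Unset Strict Implicit.
Unset Printing Implicit Defensive.
Import Order.TTheory GRing.Theory Num.Theory.

Local Open Scope classical_set_scope.
Local Open Scope ring_scope.

(* Isomorphic, as a measurable space, to a Polish space with its Borel
   sigma-algebra.  A measurableType is inhabited; the empty standard Borel space
   is recovered as a Borel subset (see [carrier] below). *)
Definition standard_borel (F : realType) d (T : measurableType d) : Prop :=
  exists (P : completePseudoMetricType F) (f : T -> P),
    [/\ hausdorff_space P, @second_countable P, bijective f &
        forall B : set T, measurable B <-> <<s @open P >> (f @` B)].

Section Relations.
Context (F : realType) d (X : measurableType d).
Implicit Types (R S K : set (X * X)) (A B : set X).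

Definition equiv_rel R : Prop :=
  [/\ forall x, R (x, x),
      forall x y, R (x, y) -> R (y, x) &
      forall x y z, R (x, y) -> R (y, z) -> R (x, z)].

Definition borel_equiv_rel R : Prop := measurable R /\ equiv_rel R.

Definition eclass R (x : X) : set X := [set y | R (y, x)].

Definition pmp (mu : probability X F) R : Prop :=
  borel_equiv_rel R /\
  forall K, measurable K -> K `<=` R ->
    (\int[mu]_x (counting (xsection K x) : \bar F) =
     \int[mu]_y (counting (ysection K y) : \bar F))%E.

Definition invariant R A : Prop := forall x y, R (x, y) -> A y -> A x.

(* Statements up to null sets hold after restriction to such an [A]. *)
Definition conull_invariant (mu : probability X F) R A : Prop :=
  [/\ measurable A, mu (~` A) = 0%E & invariant R A].

(* [A] is meant to be R-invariant, and [S] a subrelation of [R]. *)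
Definition has_index_on A S R (n : nat) : Prop :=
  exists f : 'I_n -> X -> X,
    [/\ forall i, measurable_fun A (f i),
        forall i x, A x -> A (f i x) &
        forall x, A x ->
          trivIset setT (fun i => eclass S (f i x)) /\
          \bigcup_i eclass S (f i x) = eclass R x].

Definition finite_index_on A S R : Prop :=
  exists (m : nat) (B : 'I_m -> set X),
    [/\ forall j, measurable (B j) /\ invariant R (B j),
        trivIset setT B, \bigcup_j B j = A &
        forall j, exists n, has_index_on (B j) S R n].

End Relations.

(* Graphs are given by source and range maps, with no edge inversion: each edge
   counts once and is traversed both ways, (e, true) from [s e] to [r e] and
   (e, false) from [r e] to [s e].  Loops and parallel edges are allowed in
   graphs, hence are cycles. *)
Section Graphs.
Context (VT ET : choiceType) (s r : ET -> VT).

Definition step_start (a : ET * bool) : VT := if a.2 then s a.1 else r a.1.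
Definition step_end (a : ET * bool) : VT := if a.2 then r a.1 else s a.1.

Fixpoint walk (E : set ET) (v : VT) (p : seq (ET * bool)) (w : VT) : Prop :=
  if p is a :: p' then
    [/\ E a.1, step_start a = v & walk E (step_end a) p' w]
  else v = w.

Definition same_component (E : set ET) (v w : VT) : Prop :=
  exists p, walk E v p w.

Definition countable_graph (V : set VT) (E : set ET) : Prop :=
  [/\ countable V, countable E & forall e, E e -> V (s e) /\ V (r e)].

Definition connected_graph (V : set VT) (E : set ET) : Prop :=
  V !=set0 /\ forall v w, V v -> V w -> same_component E v w.

Definition acyclic_graph (E : set ET) : Prop :=
  forall v p, walk E v p v ->
    uniq (map fst p) -> uniq (map step_start p) -> p = [::].

Definition tree (V : set VT) (E : set ET) : Prop :=
  [/\ countable_graph V E, connected_graph V E & acyclic_graph E].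

End Graphs.

Section Treeings.
Context (F : realType) d (X : measurableType d).
Implicit Types (R S K : set (X * X)) (A : set X).

(* [A] is meant to be S-invariant.  A pair (x, y) is an edge from y to x. *)
Definition treeing_on A S K : Prop :=
  [/\ measurable K,
      K `<=` S `&` (A `*` A),
      forall x y, A x -> A y -> (same_component snd fst K x y <-> S (x, y)) &
      forall x, A x ->
        tree snd fst (eclass S x) (K `&` (eclass S x `*` eclass S x))].

Definition treeable (mu : probability X F) R : Prop :=
  exists A, conull_invariant mu R A /\ exists K, treeing_on A R K.

Definition admits_finite_index_treeable (mu : probability X F) R : Prop :=
  exists A, conull_invariant mu R A /\
  exists S, [/\ borel_equiv_rel S, S `<=` R, finite_index_on A S R &
                exists K, treeing_on A S K].

End Treeings.

(* R-spaces over an R-invariant Borel set [A], given by their total space, which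
   is a Borel subset [carrier] of a standard Borel space.  [act x v] stands for
   (x, y) v, where v lies over y and (x, y) is in R; values of [proj] and [act]
   elsewhere are irrelevant. *)
Record rspace (F : realType) d (X : measurableType d)
    (R : set (X * X)) (A : set X) := RSpace {
  rs_display : measure_display;
  rs_type :> measurableType rs_display;
  carrier : set rs_type;
  proj : rs_type -> X;
  act : X -> rs_type -> rs_type;
  rs_standard : standard_borel F rs_type;
  carrier_measurable : measurable carrier;
  proj_measurable : measurable_fun carrier proj;
  proj_base : forall v, carrier v -> A (proj v);
  act_carrier : forall x v, carrier v -> R (x, proj v) -> carrier (act x v);
  act_proj : forall x v, carrier v -> R (x, proj v) -> proj (act x v) = x;
  act_id : forall v, carrier v -> act (proj v) v = v;
  act_comp : forall x y v, carrier v -> R (x, y) -> R (y, proj v) ->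
    act x (act y v) = act x v;
  act_measurable :
    measurable_fun [set xv : X * rs_type | carrier xv.2 /\ R (xv.1, proj xv.2)]
      (fun xv => act xv.1 xv.2) }.

Arguments carrier {F d X R A} Y : rename.
Arguments proj {F d X R A} Y : rename.
Arguments act {F d X R A} Y : rename.

Section RSpaces.
Context (F : realType) d (X : measurableType d) (R : set (X * X)) (A : set X).
Implicit Types Y : rspace F R A.

Definition fiber Y (x : X) : set Y := [set v | carrier Y v /\ proj Y v = x].

Definition countable_rset Y : Prop := forall x, countable (@fiber Y x).

Definition orbit Y (v : Y) : set Y :=
  [set w | exists x, R (x, proj Y v) /\ w = act Y x v].

Definition fundamental_domain Y (D : set Y) : Prop :=
  [/\ measurable D, D `<=` carrier Y &
      forall v, carrier Y v -> exists! w, (D `&` orbit v) w].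

Definition quasi_periodic Y : Prop := exists D : set Y, fundamental_domain D.

End RSpaces.

Arguments fiber {F d X R A} Y x _ : rename.

Record rtree (F : realType) d (X : measurableType d)
    (R : set (X * X)) (A : set X) := RTree {
  vertices : rspace F R A;
  edges : rspace F R A;
  src : edges -> vertices;
  rng : edges -> vertices;
  vertices_countable : countable_rset vertices;
  edges_countable : countable_rset edges;
  src_measurable : measurable_fun (carrier edges) src;
  rng_measurable : measurable_fun (carrier edges) rng;
  src_act : forall x e, carrier edges e -> R (x, proj edges e) ->
    src (act edges x e) = act vertices x (src e);
  rng_act : forall x e, carrier edges e -> R (x, proj edges e) ->
    rng (act edges x e) = act vertices x (rng e);
  fiber_tree : forall x, A x ->
    tree src rng (fiber vertices x) (fiber edges x) }.

Arguments vertices {F d X R A} T : rename.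
Arguments edges {F d X R A} T : rename.

Section AlmostEquality.
Context (F : realType) d (X : measurableType d) (R : set (X * X)).
Context (E : rspace F R setT).

Definition almost_equal (u v : set E) : Prop := finite_set (u `+` v).

Definition almost_equality_class (G : set E) (C : set (set E)) : Prop :=
  exists2 u, u `<=` G & C = [set v | v `<=` G /\ almost_equal u v].

(* Total space of the field (E, Z_2): subsets of a fibre of E stand for
   functions from this fibre to Z/2Z. *)
Definition power_field : set (X * set E) :=
  [set xu | xu.2 `<=` fiber E xu.1].

Definition borel_section (B : set X) (s : X -> E) : Prop :=
  [/\ measurable B, measurable_fun B s &
      forall x, B x -> fiber E x (s x)].

(* The Borel structure of (E, Z_2): the coarsest one for which the projection
   to X and the evaluations u |-> u(s(x)) along partial Borel sections s of E
   are Borel. *)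
Definition power_field_borel : set (set (X * set E)) :=
  <<s power_field,
    [set C | exists2 B : set X, measurable B &
               C = power_field `&` [set xu | B xu.1]] `|`
    [set C | exists (B : set X) (s : X -> E), borel_section B s /\
               C = power_field `&` [set xu | B xu.1 /\ xu.2 (s xu.1)]] >>.

(* (x, y) u, given by ((x, y) u)(e) = u((y, x) e) for e in the fibre over x. *)
Definition power_act (x y : X) (u : set E) : set E :=
  [set e | fiber E x e /\ u (act E y e)].

Definition field_fiber (V : set (X * set E)) (x : X) : set (set E) :=
  [set u | V (x, u)].

Definition stable_almost_equality_class (V : set (X * set E)) : Prop :=
  [/\ power_field_borel V,
      forall x, almost_equality_class (fiber E x) (field_fiber V x) &
      forall x y, R (x, y) ->
        power_act x y @` field_fiber V y = field_fiber V x].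

(* Over [A], the vertex set of T and V are isomorphic as R-spaces: [phi] is
   bijective on fibres, equivariant, and a Borel isomorphism of total spaces. *)
Definition is_vertex_set (V : set (X * set E)) (A : set X)
    (T : rtree F R A) : Prop :=
  let VT := vertices T in
  exists phi : VT -> set E,
    [/\ forall x, A x -> set_bij (fiber VT x) (field_fiber V x) phi,
        forall x v, carrier VT v -> R (x, proj VT v) ->
          phi (act VT x v) = power_act x (proj VT v) (phi v) &
        forall B : set VT, B `<=` carrier VT ->
          (measurable B <->
           power_field_borel [set (proj VT v, phi v) | v in B])].

End AlmostEquality.

Definition almost_stability (F : realType) : Prop :=
  forall (d : measure_display) (X : measurableType d) (mu : probability X F)
    (R : set (X * X)),
  standard_borel F X -> pmp mu R ->
  forall E : rspace F R setT, countable_rset E -> quasi_periodic E ->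
  forall V : set (X * set E), stable_almost_equality_class V ->
  exists A, conull_invariant mu R A /\
  exists T : rtree F R A, is_vertex_set V T /\ quasi_periodic (edges T).

(* Main.v *)
From HB Require Import structures.
From mathcomp Require Import all_boot all_order all_algebra.
From mathcomp Require Import all_classical all_reals all_analysis.
Require Import Defs.
From mathcomp Require Import ring.

(** Let K be a treeing of the finite index subrelation S. Over each point x put
the set E of the edges of K lying in the R-class of x; R acts on E by moving the
base point only, so E is quasi-periodic. Choose a point in each of the finitely
many S-classes inside the R-class of x and orient every tree of K towards the
chosen point. Another choice changes the orientation along finitely many finite
paths only, hence the almost equality class of this orientation, seen as a
subset of E, depends on the R-class alone ([almost_class_stable]). The almost
stability theorem turns it into the vertex set of an R-tree T.

An element u of the class differs from an orientation towards points at finitely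
many edges, so following its arrows ends after finitely many steps
([sink_exists]) and it has finitely many sinks ([sink_cases]). The least sink,
for a Borel linear order of X, is a Borel equivariant map pi from the vertices of
T to the points of their class ([vertex_point]). Finally T is contracted onto X:
for each value z of pi one vertex with image z is kept as a centre, and all the
vertices are attached step by step to centres through edges of T, in a Borel and
equivariant way, since the base point pi v makes the countably many edges at v an
enumerated set ([contraction]). Collapsing the resulting connected blocks gives a
tree on the values of pi, and the remaining points of X are attached to it as
leaves ([treeing_of_rtree]).

All the Borel choices rest on the theorem of Lusin and Novikov
([lusin_novikov]): Borel sets with countable sections are covered by countably
many graphs of Borel functions. It is proved on Baire space, which contains every
standard Borel space as a Borel retract ([standard_coded]), from the separation
theorem for analytic sets ([analytic_separation]) and a splitting argument that
produces a perfect set in some section of a set that countably many Borel graphs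
do not cover ([large_split], [large_section]). Acyclicity is always used and
proved through cuts: an edge is a bridge exactly when some property of vertices
separates its ends and is respected by all other edges ([acyclic_bridge],
[cut_acyclic]). *)

Set Implicit Arguments.
Unset Strict Implicit.
Unset Printing Implicit Defensive.
Local Open Scope classical_set_scope.

(** * Walks, forests and orientations of forests *)

Section Walks.
Context (VT ET : choiceType) (s r : ET -> VT).
Implicit Types (E : set ET) (v w : VT) (e : ET) (p : seq (ET * bool)).

Local Notation conn := (same_component s r).

Lemma walk_cat E v p q w :
  walk s r E v (p ++ q) w <-> exists2 u, walk s r E v p u & walk s r E u q w.
Proof.
elim: p v => [|a p IH] v /=.
  by split => [H|[u ->]//]; exists v.
split=> [[Ea sa /IH[u pu qu]]|[u [Ea sa pu] qu]]; first by exists u.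
by split=> //; apply/IH; exists u.
Qed.

Lemma walk_sub E E' v p w : E `<=` E' -> walk s r E v p w -> walk s r E' v p w.
Proof. by move=> EE'; elim: p v => //= a p IH v [/EE' ? ? /IH]. Qed.

Lemma walk_avoid E v p w e :
  walk s r E v p w -> e \notin map fst p -> walk s r (E `\ e) v p w.
Proof.
elim: p v => //= a p IH v [Ea sa /IH pw]; rewrite inE negb_or => /andP[ea ep].
by split=> //; [split=> // ae; rewrite ae eqxx in ea|exact: pw].
Qed.

Lemma conn_refl E v : conn E v v. Proof. by exists [::]. Qed.

Lemma conn_trans E v w u : conn E v w -> conn E w u -> conn E v u.
Proof. by move=> [p vp] [q wq]; exists (p ++ q); apply/walk_cat; exists w. Qed.

Lemma conn_edge E e : E e -> conn E (s e) (r e).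
Proof. by move=> Ee; exists [:: (e, true)]. Qed.

Lemma conn_edgeV E e : E e -> conn E (r e) (s e).
Proof. by move=> Ee; exists [:: (e, false)]. Qed.

(** Stands in for induction on walks in all that follows, and is where cuts of
a graph act. *)
Lemma conn_invariant E (P : VT -> Prop) :
  (forall e, E e -> (P (s e) <-> P (r e))) ->
  forall v w, conn E v w -> P v -> P w.
Proof.
move=> HP v w [p]; elim: p v => [|[e b] p IH] v /=; first by move=> ->.
case=> Ee <- /IH; have := HP e Ee.
by case: b; rewrite /step_start /step_end /=; tauto.
Qed.

Lemma conn_sym E v w : conn E v w -> conn E w v.
Proof.
move=> vw.
apply: (@conn_invariant E (conn E ^~ v)) vw (conn_refl _ _) => e Ee.
by split; apply: conn_trans; [exact: conn_edgeV | exact: conn_edge].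
Qed.

Lemma walk_suffix E v p w z :
  walk s r E v p w -> uniq (v :: map (step_end s r) p) -> uniq (map fst p) ->
  z \in v :: map (step_end s r) p ->
  exists q, [/\ walk s r E z q w, uniq (z :: map (step_end s r) q) &
                uniq (map fst q)].
Proof.
elim: p v => [|a p IH] v vp uv ue zin.
  by exists [::]; rewrite mem_seq1 in zin; rewrite (eqP zin).
have [zv|zv] := eqVneq z v; first by exists (a :: p); rewrite zv.
move: vp => /= [_ _ ap]; move: uv ue zin => /= /andP[_ uv] /andP[_ ue].
by rewrite inE (negbTE zv) => zin; apply: IH ap uv ue zin.
Qed.

Lemma walk_ends E v p w e : walk s r E v p w -> e \in map fst p ->
  s e \in v :: map (step_end s r) p /\ r e \in v :: map (step_end s r) p.
Proof.
elim: p v => [|[f b] p IH] v //= [Ef sv ap]; rewrite inE => /orP[/eqP ->|ep].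
  rewrite /step_start /step_end /= in sv *.
  by case: b sv {ap} => /= <-; rewrite !inE !eqxx orbT.
have [H1 H2] := IH _ ap ep.
by split; rewrite in_cons ?H1 ?H2 orbT.
Qed.

Lemma simple_walk E v w : conn E v w ->
  exists p, [/\ walk s r E v p w, uniq (v :: map (step_end s r) p) &
                uniq (map fst p)].
Proof.
move=> [p]; elim: p v => [|a p IH] v; first by move=> ->; exists [::].
move=> /= [Ea sv /IH[q [aq uq ue]]].
have [vin|vnin] := boolP (v \in step_end s r a :: map (step_end s r) q).
  by have [q' H] := walk_suffix aq uq ue vin; exists q'.
exists (a :: q); split=> //; first by rewrite /= in vnin uq *; rewrite vnin.
rewrite /= ue andbT; apply/negP => /(walk_ends aq)[H1 H2].
by move: vnin; rewrite -sv /step_start; case: ifP; rewrite ?H1 ?H2.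
Qed.

(** A walk joining the ends of e without using e could be shortened to a simple
one, which e would close into a cycle. *)
Lemma acyclic_bridge E e :
  acyclic_graph s r E -> E e -> ~ conn (E `\ e) (s e) (r e).
Proof.
move=> ac Ee /conn_sym /simple_walk[p [wp uv ue]].
suff : (e, true) :: p = [::] by [].
apply: (ac (s e)) => /=.
- by split=> //; apply: walk_sub wp => ? [].
- rewrite ue andbT; apply/negP => ep; suff : (E `\ e) e by move=> [_]; apply.
  have : forall f, f \in map fst p -> (E `\ e) f.
    elim: p (r e) wp {uv ue ep} => //= a p IH v [Ea _ /IH ap] f.
    by rewrite inE => /orP[/eqP ->|/ap].
  by apply.
- have starts : forall q v w, walk s r (E `\ e) v q w ->
      rcons (map (step_start s r) q) w = v :: map (step_end s r) q.
    by elim=> [|a q IH] v w /=; [move=> ->|case=> _ -> /IH ->].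
  by rewrite -rcons_uniq (starts _ _ _ wp).
Qed.

(** Acyclicity is proved by exhibiting cuts: the first edge of a cycle changes
sides, and no other edge of the cycle can change back. *)
Lemma cut_acyclic E :
  (forall e, E e -> exists chi : VT -> Prop,
     [/\ chi (s e), ~ chi (r e) &
      forall f, E f -> f <> e -> (chi (s f) <-> chi (r f))]) ->
  acyclic_graph s r E.
Proof.
move=> cut v [//|[e b] p] /= [Ee sv ep] /andP[enp _] _; exfalso.
have [chi [chis chir chiE]] := cut e Ee.
have /(@conn_invariant _ chi) inv : forall f, (E `\ e) f -> (chi (s f) <-> chi (r f)).
  by move=> f [Ef fe]; apply: chiE.
have ev : conn (E `\ e) (step_end s r (e, b)) v by exists p; apply: walk_avoid.
have := inv _ _ ev; have := inv _ _ (conn_sym ev).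
by rewrite -sv /step_start /step_end /=; case: (b) => /=; tauto.
Qed.

(** Orientation of the forest E towards v: e points from [s e] to [r e] exactly
when v lies on the side of [r e] once e is removed. *)
Definition towards E v e : Prop := conn (E `\ e) v (r e).

Lemma towards_src E e : acyclic_graph s r E -> E e -> ~ towards E (s e) e.
Proof. exact: acyclic_bridge. Qed.

Lemma towards_rng E e : towards E (r e) e.
Proof. exact: conn_refl. Qed.

Lemma towards_conn E v w e :
  conn (E `\ e) v w -> (towards E v e <-> towards E w e).
Proof.
move=> vw; split; apply: conn_trans => //; exact: conn_sym.
Qed.

Lemma towards_move E e f : E f -> f <> e ->
  (towards E (s f) e <-> towards E (r f) e).
Proof. by move=> Ef fe; apply: towards_conn; apply: conn_edge. Qed.

(** Moving the target along an edge reverses that edge only. *)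
Lemma towards_almost E v w : conn E v w ->
  exists l : seq ET, forall e, e \notin l -> (towards E v e <-> towards E w e).
Proof.
pose P w := exists l : seq ET,
  forall e, e \notin l -> (towards E v e <-> towards E w e).
have /(@conn_invariant _ P) inv : forall f, E f -> (P (s f) <-> P (r f)).
  move=> f Ef; split=> -[l Hl]; exists (f :: l) => e; rewrite inE negb_or;
    move=> /andP[/eqP ef /Hl ->]; rewrite towards_move //; exact/nesym.
by move=> /inv; apply; exists [::].
Qed.

Definition sink E (u : set ET) v : Prop :=
  forall e, E e -> (r e = v -> u e) /\ (s e = v -> ~ u e).

(** Following arrows of u from v: each step crosses an edge on which u disagrees
with the orientation towards the current vertex, and repairs that edge. *)
Lemma sink_exists E u (l : seq ET) v : acyclic_graph s r E ->
  (forall e, E e -> conn E v (r e) -> e \notin l -> (u e <-> towards E v e)) ->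
  exists2 w, conn E v w & sink E u w.
Proof.
move=> ac; have [n] := ubnP (size l); elim: n l v => // n IH l v ln Hl.
have [sv|] := pselect (sink E u v); first by exists v => //; exact: conn_refl.
have step : forall e w, E e -> conn E v w -> conn E v (r e) ->
    (forall f, E f -> f <> e -> (towards E v f <-> towards E w f)) ->
    ~ (u e <-> towards E v e) -> (u e <-> towards E w e) ->
    exists2 w, conn E v w & sink E u w.
  move=> e w Ee vw ve vwf uv uw.
  have el : e \in l by apply/negPn/negP => /Hl; apply: contra_not uv; exact.
  have [] := IH [seq f <- l | f != e] w.
  - rewrite -ltnS; apply: leq_trans ln; rewrite ltnS size_filter.
    by rewrite -(count_predC (pred1 e) l) -[ltnLHS]add0n ltn_add2r -has_count has_pred1.
  - move=> f Ef wf; rewrite mem_filter negb_and => fl.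
    have [->//|fe] := pselect (f = e).
    rewrite -vwf//; apply: Hl => //; first exact: conn_trans wf.
    by move/eqP: fe fl => ->.
  - by move=> w' ww' sw'; exists w' => //; apply: conn_trans ww'.
move=> /existsNP[e] /not_implyP[Ee] /not_andP[] /not_implyP[ev ue].
  apply: (step e (s e)) => //; rewrite -?ev; try exact: conn_edgeV.
  + exact: conn_refl.
  + by move=> f Ef fe; apply: iff_sym; apply: towards_move => //; exact: nesym.
  + by move=> [_]; apply: contra_not ue; apply; exact: towards_rng.
  + by split=> // H; case: (towards_src ac Ee H).
apply: (step e (r e)) => //; rewrite -?ev; try exact: conn_edge.
+ by move=> f Ef fe; apply: towards_move => //; exact: nesym.
+ by move=> [+ _] => /(_ (contrapT ue)); apply: towards_src.
+ by split=> // _; [exact: towards_rng|exact: contrapT].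
Qed.

(** From a sink w other than v, the first edge of the walk to v points towards v
in one orientation and towards w in the other. *)
Lemma sink_cases E u (l : seq ET) v w : acyclic_graph s r E ->
  (forall e, E e -> conn E v (r e) -> e \notin l -> (u e <-> towards E v e)) ->
  conn E v w -> sink E u w ->
  w = v \/ exists2 e, e \in l & (w = s e \/ w = r e).
Proof.
move=> ac Hl vw sw; have /simple_walk[p [wp _ ue]] := conn_sym vw.
case: p wp ue => [|[e b] p] /=; first by left.
move=> [Ee sb ep] /andP[enp _]; right.
have cv : conn (E `\ e) v (step_end s r (e, b)).
  by apply: conn_sym; exists p; apply: walk_avoid.
have ve : conn E v (r e).
  apply: (conn_trans vw); rewrite -sb /step_start /=; case: (b) => //=.
    exact: conn_edge.
  exact: conn_refl.
exists e; last by move: sb; rewrite /step_start; case: ifP => _ <-; [left|right].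
apply/negPn/negP => /(Hl e Ee ve) [ut tu].
have [rw sw'] := sw e Ee.
move: sb cv; rewrite /step_start /step_end /=; case: (b) => /= sb cv.
  by apply: (sw' sb); apply: tu.
apply: (towards_src ac Ee); apply/(towards_conn cv); exact/ut/rw.
Qed.

End Walks.

(** * Borel predicates and Baire space *)

Lemma choose_fun X Y (P : X -> Y -> Prop) :
  (forall x, exists y, P x y) -> exists f, forall x, P x (f x).
Proof. by move=> /choice[f Pf]; exists f. Qed.

Section BorelPredicates.
Context (T : Type) (D : set T) (M : set (set T)) (HM : sigma_algebra D M).
Implicit Types (P Q : T -> Prop).

(** The sigma-algebra M on D is a parameter because it is also instantiated with
the Borel structure of a field of power sets, which is generated on a proper
subset of the type of pairs. *)
Definition bor P : Prop := M (D `&` [set x | P x]).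

Lemma bor_ext P Q : (forall x, D x -> (P x <-> Q x)) -> bor P -> bor Q.
Proof.
move=> PQ; rewrite /bor; suff -> : D `&` [set x | P x] = D `&` [set x | Q x] by [].
by apply/seteqP; split=> x [Dx] /(PQ x Dx).
Qed.

Lemma bor_not P : bor P -> bor (fun x => ~ P x).
Proof.
case: HM => _ MD _ /MD; rewrite /bor.
suff -> : D `\` (D `&` [set x | P x]) = D `&` [set x | ~ P x] by [].
by apply/seteqP; split=> x /= [Dx nP]; split=> //; [move=> Px|move=> [_]//]; apply: nP.
Qed.

Lemma bor_ex (P : nat -> T -> Prop) :
  (forall n, bor (P n)) -> bor (fun x => exists n, P n x).
Proof.
case: HM => _ _ MU H; rewrite /bor.
suff -> : D `&` [set x | exists n, P n x] = \bigcup_n (D `&` [set x | P n x]).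
  exact: MU.
apply/seteqP; split=> x /= [] => [Dx [n Pn]|n _ [Dx Pn]]; first by exists n.
by split=> //; exists n.
Qed.

Lemma bor_all (P : nat -> T -> Prop) :
  (forall n, bor (P n)) -> bor (fun x => forall n, P n x).
Proof.
move=> H; apply: (@bor_ext (fun x => ~ exists n, ~ P n x)).
  by move=> x _; split=> [/forallNP ? n|? [n]]; [exact: contrapT|apply].
by apply/bor_not/bor_ex => n; apply: bor_not.
Qed.

Lemma bor_or P Q : bor P -> bor Q -> bor (fun x => P x \/ Q x).
Proof.
move=> HP HQ; apply: (@bor_ext (fun x => exists n, (if n is 0 then P else Q) x)).
  move=> x _; split=> [[[|n] ?]|[?|?]]; [by left|by right|by exists 0|by exists 1].
by apply: bor_ex => -[|n].
Qed.

Lemma bor_and P Q : bor P -> bor Q -> bor (fun x => P x /\ Q x).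
Proof.
move=> HP HQ; apply: (@bor_ext (fun x => forall n, (if n is 0 then P else Q) x)).
  by move=> x _; split=> [H|[? ?] [|n]//]; split; [exact: (H 0)|exact: (H 1)].
by apply: bor_all => -[|n].
Qed.

Lemma bor_imp P Q : bor P -> bor Q -> bor (fun x => P x -> Q x).
Proof.
move=> HP HQ; apply: (@bor_ext (fun x => ~ P x \/ Q x)).
  by move=> x _; have [?|?] := pselect (P x); split; tauto.
by apply: bor_or => //; apply: bor_not.
Qed.

Lemma bor_iff P Q : bor P -> bor Q -> bor (fun x => P x <-> Q x).
Proof. by move=> HP HQ; apply: bor_and; apply: bor_imp. Qed.

Lemma bor_const (Q : Prop) : bor (fun=> Q).
Proof.
have [q|nq] := pselect Q; last first.
  by rewrite /bor; suff -> : D `&` [set _ | Q] = set0; [case: HM|rewrite -subset0 => x []].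
have b0 : bor (fun=> False).
  by rewrite /bor; suff -> : D `&` [set _ | False] = set0; [case: HM|rewrite -subset0 => x []].
by apply: (bor_ext _ (bor_not b0)) => x _; split=> // _ [].
Qed.

End BorelPredicates.

Section Measurable.
Context d (T : measurableType d).

Lemma measurable_sigma (D : set T) : measurable D -> sigma_algebra D measurable.
Proof.
move=> mD; split=> [|A mA|A mA]; first exact: measurable0.
  exact: measurableD.
exact: bigcupT_measurable.
Qed.

Definition mbor (D : set T) (P : T -> Prop) : Prop := bor D measurable P.

Lemma mborT (P : T -> Prop) : mbor setT P = measurable [set x | P x].
Proof. by rewrite /mbor /bor setTI. Qed.

Context (D : set T) (mD : measurable D).
Implicit Types (P Q : T -> Prop).

Lemma mbor_set (A : set T) : measurable A -> mbor D (fun x => A x).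
Proof. by move=> mA; apply: measurableI. Qed.

Lemma mbor_ext P Q : (forall x, D x -> (P x <-> Q x)) -> mbor D P -> mbor D Q.
Proof. exact: bor_ext. Qed.
Lemma mbor_not P : mbor D P -> mbor D (fun x => ~ P x).
Proof. exact: (bor_not (measurable_sigma mD)). Qed.
Lemma mbor_ex (P : nat -> T -> Prop) :
  (forall n, mbor D (P n)) -> mbor D (fun x => exists n, P n x).
Proof. exact: (bor_ex (measurable_sigma mD)). Qed.
Lemma mbor_all (P : nat -> T -> Prop) :
  (forall n, mbor D (P n)) -> mbor D (fun x => forall n, P n x).
Proof. exact: (bor_all (measurable_sigma mD)). Qed.
Lemma mbor_or P Q : mbor D P -> mbor D Q -> mbor D (fun x => P x \/ Q x).
Proof. exact: (bor_or (measurable_sigma mD)). Qed.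
Lemma mbor_and P Q : mbor D P -> mbor D Q -> mbor D (fun x => P x /\ Q x).
Proof. exact: (bor_and (measurable_sigma mD)). Qed.
Lemma mbor_imp P Q : mbor D P -> mbor D Q -> mbor D (fun x => P x -> Q x).
Proof. exact: (bor_imp (measurable_sigma mD)). Qed.
Lemma mbor_const (Q : Prop) : mbor D (fun=> Q).
Proof. exact: (bor_const (measurable_sigma mD)). Qed.

End Measurable.

Lemma mbor_comp d1 d2 (T1 : measurableType d1) (T2 : measurableType d2)
    (D : set T1) (f : T1 -> T2) (B : set T2) :
  measurable D -> measurable_fun D f -> measurable B -> mbor D (fun x => B (f x)).
Proof. by move=> mD mf mB; apply: mf. Qed.

(** The cylinders generate the Borel sets of the product topology; the topology
itself is only used through [agree] and [closedN] below. *)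
Definition cylinders : set (set (nat -> nat)) :=
  [set B | exists i k, B = [set x | x i = k]].
Definition Baire := g_sigma_algebraType cylinders.

Section Baire.

Lemma measurable_coord i k : measurable [set x : Baire | x i = k].
Proof. by apply: sub_sigma_algebra; exists i, k. Qed.

Lemma measurable_Baire d (T : measurableType d) (D : set T) (f : T -> Baire) :
  measurable D -> (forall i k, mbor D (fun x => f x i = k)) -> measurable_fun D f.
Proof.
move=> mD H; apply: (@measurability _ _ T Baire D f cylinders erefl).
by move=> _ [_ [i [k ->]] <-]; apply: H.
Qed.

Lemma mbor_coord d (T : measurableType d) (D : set T) (f : T -> Baire) i k :
  measurable D -> measurable_fun D f -> mbor D (fun x => f x i = k).
Proof. by move=> mD mf; apply: (mf mD [set x | x i = k]); exact: measurable_coord. Qed.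

End Baire.

(** * Analytic subsets of Baire space *)

Section Analytic.
Implicit Types (x y z w v : nat -> nat) (A B C : set (nat -> nat)).

Definition agree n x y : Prop := forall i, i < n -> x i = y i.

(* Closedness in the product topology. *)
Definition closedN C : Prop :=
  forall x, (forall n, exists2 y, C y & agree n x y) -> C x.

(* Interleaving and unfolding of sequences, which turn finite and countable
products of copies of Baire space into subspaces of Baire space. *)
Definition pairN x y : nat -> nat := fun i => if odd i then y i./2 else x i./2.
Definition fstN z : nat -> nat := fun i => z i.*2.
Definition sndN z : nat -> nat := fun i => z i.*2.+1.
Definition colN (k : nat) z : nat -> nat := fun m => z (pickle (k, m)).
Definition tableN (f : nat -> nat -> nat) : nat -> nat :=
  fun i => if unpickle i is Some (k, m) then f k m else 0.
Definition shiftN z : nat -> nat := fun i => z i.+1.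

Lemma fstK x y : fstN (pairN x y) = x.
Proof. by apply/funext => i; rewrite /fstN /pairN odd_double doubleK. Qed.

Lemma sndK x y : sndN (pairN x y) = y.
Proof.
by apply/funext => i; rewrite /sndN /pairN /= odd_double /= uphalf_double.
Qed.

Lemma pairK z : pairN (fstN z) (sndN z) = z.
Proof.
apply/funext => i; rewrite /pairN /fstN /sndN; case: ifP => oi.
  by rewrite -[in RHS](odd_double_half i) oi.
by rewrite -[in RHS](odd_double_half i) oi.
Qed.

Lemma tableK f k : colN k (tableN f) = f k.
Proof. by apply/funext => m; rewrite /colN /tableN pickleK. Qed.

(* Continuity in the product topology, uniform in the point; all the maps used
below merely rearrange coordinates. *)
Definition contN (f : (nat -> nat) -> (nat -> nat)) : Prop :=
  forall n, exists m, forall x y, agree m x y -> agree n (f x) (f y).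

Lemma agree_le m n x y : m <= n -> agree n x y -> agree m x y.
Proof. by move=> mn H i /leq_trans - /(_ _ mn); apply: H. Qed.

Lemma contN_reindex (j : nat -> nat) : contN (fun x i => x (j i)).
Proof.
move=> n; exists (\max_(i < n) (j i).+1) => x y xy i ilt.
by apply: xy; apply: (@leq_bigmax _ (fun i : 'I_n => (j i).+1) (Ordinal ilt)).
Qed.

Lemma contN_id : contN id. Proof. exact: contN_reindex. Qed.
Lemma contN_comp f g : contN f -> contN g -> contN (fun x => f (g x)).
Proof.
by move=> cf cg n; have [m Hm] := cf n; have [l Hl] := cg m; exists l => x y /Hl/Hm.
Qed.
Lemma contN_fst f : contN f -> contN (fun x => fstN (f x)).
Proof. by apply: contN_comp; exact: contN_reindex. Qed.
Lemma contN_snd f : contN f -> contN (fun x => sndN (f x)).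
Proof. by apply: contN_comp; exact: contN_reindex. Qed.
Lemma contN_col k f : contN f -> contN (fun x => colN k (f x)).
Proof. by apply: contN_comp; exact: contN_reindex. Qed.
Lemma contN_shift f : contN f -> contN (fun x => shiftN (f x)).
Proof. by apply: contN_comp; exact: contN_reindex. Qed.
Lemma contN_pair f g : contN f -> contN g -> contN (fun x => pairN (f x) (g x)).
Proof.
move=> cf cg n; have [m Hm] := cf n; have [l Hl] := cg n.
exists (maxn m l) => x y xy i ilt; rewrite /pairN.
have hlt : i./2 < n by apply: leq_ltn_trans ilt; rewrite -divn2 leq_div.
case: ifP => _; [apply: Hl hlt|apply: Hm hlt]; apply: agree_le xy;
  [exact: leq_maxr|exact: leq_maxl].
Qed.

Ltac continuity := do ?[exact: contN_reindex | apply: contN_pair | apply: contN_fst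
  | apply: contN_snd | apply: contN_col | apply: contN_shift].

Lemma closedN_preimage f C : contN f -> closedN C -> closedN [set x | C (f x)].
Proof.
move=> cf cC x Hx; apply: cC => n; have [m Hm] := cf n.
by have [y Cy xy] := Hx m; exists (f y) => //; apply: Hm.
Qed.

Lemma closedN_all I (C : I -> set (nat -> nat)) :
  (forall i, closedN (C i)) -> closedN [set x | forall i, C i x].
Proof.
move=> cC x Hx i; apply: cC => n; have [y Cy xy] := Hx n.
by exists y.
Qed.

(** Projections of closed sets: the second factor holds a witness of membership. *)
Definition analytic A : Prop :=
  exists2 C, closedN C & forall x, A x <-> exists z, C (pairN x z).

Lemma analytic_ext A B : (forall x, A x <-> B x) -> analytic A -> analytic B.
Proof. by move=> AB [C cC H]; exists C => // x; rewrite -AB. Qed.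

Lemma analytic_closed C : closedN C -> analytic C.
Proof.
move=> cC; exists [set w | C (fstN w)].
  by apply: closedN_preimage cC; apply: contN_fst contN_id.
by move=> x; split=> [Cx|[z]] /=; [exists x|]; rewrite /= fstK.
Qed.

Lemma analytic_preimage f A : contN f -> analytic A -> analytic [set x | A (f x)].
Proof.
move=> cf [C cC HC]; exists [set w | C (pairN (f (fstN w)) (sndN w))].
  apply: closedN_preimage cC; continuity.
  by apply: (@contN_comp f fstN) => //; continuity.
by move=> x; split=> [/HC[z Cz]|[z /=]]; [exists z; rewrite /= fstK sndK|
  rewrite fstK sndK => Cz; apply/HC; exists z].
Qed.

Lemma analytic_choice (A : nat -> set (nat -> nat)) :
  (forall k, analytic (A k)) -> exists C : nat -> set (nat -> nat),
  (forall k, closedN (C k)) /\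
  (forall k x, A k x <-> exists z, C k (pairN x z)).
Proof.
move=> aA; have /choose_fun[C HC] : forall k, exists C : set (nat -> nat),
    closedN C /\ forall x, A k x <-> exists z, C (pairN x z).
  by move=> k; have [C ? ?] := aA k; exists C.
by exists C; split=> k; case: (HC k).
Qed.

(** A single sequence can hold witnesses for countably many conditions, one in
each column. *)
Lemma analytic_all (A : nat -> set (nat -> nat)) :
  (forall k, analytic (A k)) -> analytic [set x | forall k, A k x].
Proof.
move=> /analytic_choice [C [cC HC]].
exists [set w | forall k, C k (pairN (fstN w) (colN k (sndN w)))].
  apply: closedN_all => k; apply: closedN_preimage (cC k).
  by continuity.
move=> x; split=> [Ax|[z Hz] k].
  have /choose_fun[z Hz] : forall k, exists z, C k (pairN x z).
    by move=> k; apply/HC.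
  by exists (tableN z) => k; rewrite fstK sndK tableK.
by apply/HC; exists (colN k z); have := Hz k; rewrite fstK sndK.
Qed.

(** The first digit of the witness names the set to which the rest applies. *)
Lemma analytic_ex (A : nat -> set (nat -> nat)) :
  (forall k, analytic (A k)) -> analytic [set x | exists k, A k x].
Proof.
move=> /analytic_choice [C [cC HC]].
exists [set w | C (sndN w 0) (pairN (fstN w) (shiftN (sndN w)))].
  move=> w Hw /=.
  have cf : contN (fun w => pairN (fstN w) (shiftN (sndN w))).
    by continuity.
  apply: (closedN_preimage cf (cC (sndN w 0)) (x := w)) => n.
  have [v Cv wv] := Hw (maxn n 2); exists v; last exact: agree_le (leq_maxl _ _) wv.
  have -> : sndN w 0 = sndN v 0 by apply: wv; rewrite leq_max orbT.
  exact: Cv.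
move=> x; split=> [[k /HC[z Cz]]|[z]].
  exists (fun i => if i is i'.+1 then z i' else k).
  by rewrite /mkset fstK sndK; exact: Cz.
by rewrite /mkset fstK sndK => Cz; exists (z 0); apply/HC; exists (shiftN z).
Qed.

Lemma analytic_and A B : analytic A -> analytic B -> analytic [set x | A x /\ B x].
Proof.
move=> aA aB; apply: (@analytic_ext
    [set x | forall k : nat, (if k is 0 then A else B) x]).
  by move=> x; split=> [H|[? ?] [|k]//]; split; [exact: (H 0)|exact: (H 1)].
by apply: analytic_all => -[|k].
Qed.

Lemma analytic_proj A : analytic A -> analytic [set x | exists y, A (pairN x y)].
Proof.
move=> [C cC HC].
exists [set w | C (pairN (pairN (fstN w) (fstN (sndN w))) (sndN (sndN w)))].
  apply: closedN_preimage cC.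
  by continuity.
move=> x; split=> [[y /HC[z Cz]]|[z /=]].
  by exists (pairN y z); rewrite /= !fstK !sndK fstK.
by rewrite fstK sndK => Cz; exists (fstN z); apply/HC; exists (sndN z).
Qed.

(** The sets that are analytic together with their complement form a
sigma-algebra, and cylinders are closed and open. *)
Lemma analytic_measurable (B : set Baire) : measurable B -> analytic B.
Proof.
suff : <<s cylinders >> `<=` [set B | analytic B /\ analytic (~` B)].
  by move=> H /H[].
apply: smallest_sub; last first.
  move=> _ [i [k ->]]; split; apply: analytic_closed => x Hx.
    by have [y /= <- ->] := Hx i.+1.
  by have [y /= yk xy] := Hx i.+1; rewrite /setC /= xy.
split=> [|A [aA aAc]|A HA].
- split; first by apply: analytic_closed => x /(_ 0)[].
  by apply: analytic_closed => x /(_ 0)[y]; rewrite setC0.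
- by rewrite /= setTD setCK.
- split.
    apply: (@analytic_ext [set x | exists k, A k x]).
      by move=> x; split=> [[k]|[k _]]; exists k.
    by apply: analytic_ex => k; case: (HA k).
  apply: (@analytic_ext [set x | forall k, (~` A k) x]).
    by move=> x; rewrite setC_bigcup; split=> H k; [move=> _|]; exact: (H k).
  by apply: analytic_all => k; case: (HA k).
Qed.

Definition cyl (s : seq nat) x : Prop := forall i, i < size s -> x i = nth 0 s i.

Lemma cyl_rcons s x : cyl s x -> cyl (rcons s (x (size s))) x.
Proof.
move=> sx i; rewrite size_rcons ltnS leq_eqVlt nth_rcons => /orP[/eqP ->|ilt].
  by rewrite ltnn eqxx.
by rewrite ilt; apply: sx.
Qed.

Lemma cyl_mkseq n x : cyl (mkseq x n) x.
Proof. by move=> i; rewrite size_mkseq => ilt; rewrite nth_mkseq. Qed.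

Lemma cyl_agree s x y : cyl s x -> cyl s y -> agree (size s) x y.
Proof. by move=> sx sy i ilt; rewrite sx // sy. Qed.

Lemma measurable_cyl s : measurable [set x : Baire | cyl s x].
Proof.
rewrite -mborT; apply: (mbor_all measurableT) => i.
apply: (mbor_imp measurableT); first exact: (mbor_const measurableT).
by rewrite mborT; apply: measurable_coord.
Qed.

Lemma infinite_branch T (P : seq T -> Prop) :
  P [::] -> (forall s, P s -> exists a, P (rcons s a)) ->
  exists w : nat -> T, forall n, P (mkseq w n).
Proof.
move=> P0 PS; have [a0 _] := PS _ P0.
have /choose_fun[f Hf] : forall s, exists a, P s -> P (rcons s a).
  by move=> s; have [/PS[a Pa]|nP] := pselect (P s); [exists a|exists a0].
pose st := fix st n := if n is m.+1 then rcons (st m) (f (st m)) else [::].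
exists (fun n => f (st n)) => n.
suff -> : mkseq (fun n => f (st n)) n = st n by elim: n => //= n; apply: Hf.
by elim: n => // n IH; rewrite mkseqS IH.
Qed.

(** The separation theorem of Lusin.  If no Borel set separates A from B, the
witnesses of membership can be specified one digit at a time keeping the
corresponding pieces inseparable; in the limit they yield a point of A and a
point of B, whose neighbourhoods are separated by a cylinder. *)
Lemma analytic_separation A B : analytic A -> analytic B ->
  (forall x, A x -> ~ B x) ->
  exists D : set Baire, [/\ measurable D, A `<=` D & forall x, B x -> ~ D x].
Proof.
move=> [C cC HC] [C' cC' HC'] AB; apply: contrapT => nsep.
pose piece C s x := exists2 z, C (pairN x z) & cyl s (pairN x z).
pose sep s t := exists D : set Baire,
  [/\ measurable D, piece C s `<=` D & forall x, piece C' t x -> ~ D x].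
have step s t : ~ sep s t -> exists i j, ~ sep (rcons s i) (rcons t j).
  move=> ns; apply: contrapT => /forallNP allsep; apply: ns.
  (* Separating all the pieces pairwise would separate their unions. *)
  have {allsep} /choose_fun[D HD] : forall i, exists D : nat -> set Baire,
      forall j, [/\ measurable (D j), piece C (rcons s i) `<=` D j &
       forall x, piece C' (rcons t j) x -> ~ D j x].
    move=> i; have /choose_fun[D HD] : forall j, sep (rcons s i) (rcons t j).
      by move=> j; have /forallNP/(_ j)/contrapT := allsep i.
    by exists D.
  exists [set x | exists i, forall j, D i j x]; split.
  - rewrite -mborT; apply: (mbor_ex measurableT) => i.
    by apply: (mbor_all measurableT) => j; rewrite mborT; case: (HD i j).
  - move=> x [z Cz sz]; exists (pairN x z (size s)) => j.
    by have [_ + _] := HD (pairN x z (size s)) j; apply; exists z => //;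
      apply: cyl_rcons.
  - move=> x [z Cz sz] [i Hi].
    have [_ _ +] := HD i (pairN x z (size t)); move=> /(_ x); apply => //.
    by exists z => //; apply: cyl_rcons.
pose P (l : seq (nat * nat)) := ~ sep (map fst l) (map snd l).
have [||u Hu] := @infinite_branch _ P.
- apply: contra_not nsep => -[D [mD AD BD]]; exists D; split=> //.
    by move=> x /HC[z Cz]; apply: AD; exists z.
  by move=> x /HC'[z Cz]; apply: BD; exists z.
- by move=> l /step[i [j ns]]; exists (i, j); rewrite /P !map_rcons.
pose w i := (u i).1; pose v i := (u i).2.
have {}Hu n : ~ sep (mkseq w n) (mkseq v n).
  by have := Hu n; rewrite /P /mkseq -!map_comp.
have lim K y : closedN K -> (forall n, exists x, piece K (mkseq y n) x) -> K y.
  move=> cK H; apply: cK => n; have [x [z Kz cz]] := H n.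
  exists (pairN x z) => //; have := cyl_agree (@cyl_mkseq n y) cz.
  by rewrite size_mkseq.
have Cw : C w.
  apply: lim => // n; apply: contrapT => /forallNP npiece; apply: (Hu n).
  by exists set0; split=> // x _ [].
have Cv : C' v.
  apply: lim => // n; apply: contrapT => /forallNP npiece; apply: (Hu n).
  by exists setT; split=> // x px; case: (npiece x px).
have Aw : A (fstN w) by apply/HC; exists (sndN w); rewrite pairK.
have Bv : B (fstN v) by apply/HC'; exists (sndN v); rewrite pairK.
have [i wv] : exists i, fstN w i <> fstN v i.
  apply/existsNP => wv; apply: (AB _ Aw); suff -> : fstN w = fstN v by [].
  exact/funext.
apply: (Hu i.*2.+1); exists [set x | x i = fstN w i]; split.
- exact: measurable_coord.
- move=> x [z _ /(_ i.*2)]; rewrite size_mkseq nth_mkseq // => /(_ (ltnSn _)) E.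
  by rewrite /mkset /fstN -E -[in LHS](fstK x z).
- move=> x [z _ /(_ i.*2)]; rewrite size_mkseq nth_mkseq // => /(_ (ltnSn _)) E /=.
  by rewrite -(fstK x z) /fstN E; apply: nesym.
Qed.

Lemma measurable_fstN : measurable_fun setT (fstN : Baire -> Baire).
Proof.
apply: measurable_Baire => // i k; rewrite mborT; exact: measurable_coord.
Qed.

Lemma measurable_sndN : measurable_fun setT (sndN : Baire -> Baire).
Proof.
apply: measurable_Baire => // i k; rewrite mborT; exact: measurable_coord.
Qed.

(** For each m, the sets of x whose partner has m-th coordinate k are analytic
and pairwise disjoint; Borel sets separating them define the m-th coordinate of
a Borel function. *)
Lemma analytic_function A : analytic A ->
  (forall x y y', A (pairN x y) -> A (pairN x y') -> y = y') ->
  exists2 h : Baire -> Baire, measurable_fun setT h &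
    forall x y, A (pairN x y) -> y = h x.
Proof.
move=> aA fA.
have sep m k : exists D : set Baire,
    [/\ measurable D, forall x y, A (pairN x y) -> y m = k -> D x &
        forall x y, A (pairN x y) -> y m <> k -> ~ D x].
  have mk : measurable [set w : Baire | sndN w m = k] by exact: measurable_coord.
  have /analytic_separation : analytic [set x | exists y,
      [set w | A w /\ sndN w m = k] (pairN x y)].
    by apply: analytic_proj; apply: analytic_and => //; apply: analytic_measurable.
  move=> /(_ [set x | exists y, [set w | A w /\ ~ sndN w m = k] (pairN x y)]) [].
  - apply: analytic_proj; apply: analytic_and => //.
    apply: analytic_measurable; exact: measurableC.
  - by move=> x [y [Axy yk]] [y' [Axy']]; rewrite (fA _ _ _ Axy' Axy).
  move=> E [mE AE EA]; exists E; split=> // x y Axy yk.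
    by apply: AE; exists y; rewrite /= sndK.
  by apply: EA; exists y; rewrite /= sndK.
have /choose_fun[D HD] : forall m, exists D : nat -> set Baire, forall k,
    [/\ measurable (D k), forall x y, A (pairN x y) -> y m = k -> D k x &
        forall x y, A (pairN x y) -> y m <> k -> ~ D k x].
  by move=> m; have /choose_fun[D HD] := sep m; exists D.
(* D m k contains the x whose partner has m-th digit k, but may overlap; E m k is
made disjoint, and the digit is 0 where no E m k applies. *)
pose E m k x := D m k x /\ forall j, j < k -> ~ D m j x.
pose G m k x := E m k x \/ (k = 0 /\ forall j, ~ E m j x).
have /choose_fun[h Hh] : forall x : Baire, exists y : Baire,
    forall m, G m (y m) x.
  move=> x; suff /choose_fun[y Hy] : forall m, exists k, G m k x by exists y.
  move=> m; have [[k Ek]|/forallNP nE] := pselect (exists k, E m k x).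
    by exists k; left.
  by exists 0; right.
have Euniq m k k' x : E m k x -> E m k' x -> k = k'.
  move=> [Dk nk] [Dk' nk']; case: (ltngtP k k') => // kk.
    by case: (nk' _ kk Dk).
  by case: (nk _ kk Dk').
exists h; last first.
  move=> x y Axy; apply/funext => m.
  have Ey : E m (y m) x.
    split; first by have [_ + _] := HD m (y m); apply; first exact: Axy.
    move=> j jy; have [_ _] := HD m j; apply; first exact: Axy.
    by move=> yj; rewrite yj ltnn in jy.
  case: (Hh x m) => [|[_ /(_ _ Ey)//]]; exact: Euniq.
have mE m k : @mbor _ Baire setT (E m k).
  apply: (mbor_and measurableT); first by rewrite mborT; case: (HD m k).
  apply: (mbor_all measurableT) => j.
  apply: (mbor_imp measurableT); first exact: (mbor_const measurableT).
  by apply: (mbor_not measurableT); rewrite mborT; case: (HD m j).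
apply: measurable_Baire => // m k; apply: (@mbor_ext _ Baire _ (G m k)) => [x _|].
  split=> [Gk|<-//]; case: (Hh x m) (Gk) => [Eh|[-> nE]] [Ek|[-> nE']] //.
  - exact: Euniq Eh Ek.
  - by case: (nE' _ Eh).
  - by case: (nE _ Ek).
apply: (mbor_or measurableT) => //.
apply: (mbor_and measurableT); first exact: (mbor_const measurableT).
by apply: (mbor_all measurableT) => j; apply: (mbor_not measurableT).
Qed.

End Analytic.

(** * Countable sections on Baire space *)

Section LusinNovikovBaire.
Implicit Types (x y z w v : nat -> nat) (s t : seq nat) (l : seq (seq nat)).

Definition borel_family (H : nat -> Baire -> Baire) : Prop :=
  forall n, measurable_fun setT (H n).

Definition avoids (H : nat -> Baire -> Baire) x y : Prop := forall n, y <> H n x.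

Lemma borel_family_join (I : countType) (G : I -> nat -> Baire -> Baire) :
  (forall i, borel_family (G i)) ->
  exists2 H, borel_family H &
    forall i x y, avoids H x y -> avoids (G i) x y.
Proof.
move=> mG.
exists (fun n => if unpickle n is Some (i, m) then G i m else id).
  by move=> n; case: (unpickle n) => [[i m]|]; [exact: mG|exact: measurable_id].
move=> i x y Hxy m; have := Hxy (pickle (i, m)); rewrite pickleK; exact.
Qed.

Lemma measurable_avoids H : borel_family H ->
  measurable [set v : Baire | avoids H (fstN v) (sndN v)].
Proof.
move=> mH; rewrite -mborT; apply: (mbor_all measurableT) => n.
apply: (@mbor_ext _ Baire _ (fun v => ~ forall i, exists k,
    sndN v i = k /\ H n (fstN v) i = k)).
  move=> v _; split=> nE.
    by apply: contra_not nE => E i; exists (sndN v i); rewrite E.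
  apply: contra_not nE => E; apply/funext => i.
  by have [k [-> <-]] := E i.
apply: (mbor_not measurableT); apply: (mbor_all measurableT) => i.
apply: (mbor_ex measurableT) => k; apply: (mbor_and measurableT).
  by apply: (@mbor_coord _ _ _ (sndN : Baire -> Baire)) => //; exact: measurable_sndN.
apply: (@mbor_coord _ Baire setT (H n \o (fstN : Baire -> Baire)) i k) => //.
apply: (measurableT_comp (mH n)); exact: measurable_fstN.
Qed.

Context (C : set (nat -> nat)) (cC : closedN C).

(* Points of C code triples ((x, y), witness). *)
Let X w := fstN (fstN w).
Let Y w := sndN (fstN w).

(** A finite set of neighbourhoods is large when no countable family of Borel
functions captures the points of C lying in them: for every such family some x
has, in each of the neighbourhoods, a point above x that the family misses. *)
Definition large l : Prop := forall H, borel_family H ->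
  exists x, forall s, s \in l ->
    exists w, [/\ C w, cyl s w, X w = x & avoids H x (Y w)].

Lemma large_sub l l' : {subset l' <= l} -> large l -> large l'.
Proof. by move=> ll Ll H /Ll[x Hx]; exists x => s /ll; apply: Hx. Qed.

Definition extends s t : Prop :=
  size s < size t /\ forall w, cyl t w -> cyl s w.

Definition splits t t' : Prop :=
  forall w w', cyl t w -> cyl t' w' -> Y w <> Y w'.

(** Any neighbourhood of a large set splits.  Otherwise, after removing
countably many Borel graphs, the pairs (x, y) it contributes above the x that
meet all the other neighbourhoods form an analytic partial function, hence lie
on one more Borel graph, contradicting largeness. *)
Lemma large_split s l : large (s :: l) ->
  exists t t', [/\ extends s t, extends s t', splits t t' &
                   large (t :: t' :: l)].
Proof.
move=> Ls; apply: contrapT => nsplit.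
pose adm (tt : seq nat * seq nat) :=
  [/\ extends s tt.1, extends s tt.2 & splits tt.1 tt.2].
have /choose_fun[G HG] : forall tt, exists G, borel_family G /\ (adm tt ->
    ~ exists x, forall r, r \in [:: tt.1, tt.2 & l] ->
      exists w, [/\ C w, cyl r w, X w = x & avoids G x (Y w)]).
  move=> tt; have [att|natt] := pselect (adm tt); last first.
    by exists (fun=> id); split=> // n; exact: measurable_id.
  have /existsNP[G /not_implyP[mG nG]] : ~ large [:: tt.1, tt.2 & l].
    by case: att => ? ? ? Ltt; apply: nsplit; exists tt.1, tt.2.
  by exists G.
have [//|H mH HGH] := @borel_family_join _ G _; first by move=> tt; case: (HG tt).
pose Q r := [set v | exists z,
  [set w | [/\ C w, cyl r w & avoids H (X w) (Y w)]] (pairN v z)].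
have aQ r : analytic (Q r).
  apply: analytic_proj; apply: (@analytic_ext
    [set w | C w /\ (cyl r w /\ avoids H (X w) (Y w))]).
    by move=> w; split=> [[? []]|[]].
  apply: analytic_and; first exact: analytic_closed.
  apply: analytic_and; first by apply: analytic_measurable; exact: measurable_cyl.
  apply: (@analytic_preimage fstN [set v | avoids H (fstN v) (sndN v)]).
    exact: contN_reindex.
  by apply: analytic_measurable; exact: measurable_avoids.
have QP r w : C w -> cyl r w -> avoids H (X w) (Y w) -> Q r (pairN (X w) (Y w)).
  by move=> Cw rw Hw; exists (sndN w); rewrite /mkset pairK pairK.
pose P := [set v | Q s v /\ forall k, exists y, Q (nth s l k) (pairN (fstN v) y)].
have aP : analytic P.
  apply: analytic_and => //; apply: analytic_all => k.
  apply: (@analytic_preimage fstN [set x | exists y, Q (nth s l k) (pairN x y)]).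
    exact: contN_reindex.
  exact: analytic_proj.
have fP x y y' : P (pairN x y) -> P (pairN x y') -> y = y'.
  move=> [[z [Cw sw Hw]] Pl] [[z' [Cw' sw' Hw']] _].
  apply: contrapT => /eqP yy'.
  have /existsNP[i yi] : ~ forall i, y i = y' i by move/funext/eqP; apply/negP.
  set w := pairN (pairN x y) z in Cw sw Hw; set w' := pairN _ _ in Cw' sw' Hw'.
  have Yw : Y w = y by rewrite /Y /w fstK sndK.
  have Yw' : Y w' = y' by rewrite /Y /w' fstK sndK.
  have Xw : X w = x by rewrite /X /w !fstK.
  have Xw' : X w' = x by rewrite /X /w' !fstK.
  (* Digit i of Y w is the digit 4 i + 2 of w; prefixes of length m extend s
  properly and contain it. *)
  pose m := maxn (size s).+1 (i.*2.+1).*2.+1.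
  have ext u : cyl s u -> extends s (mkseq u m).
    move=> su; split=> [|v uv j js]; first by rewrite size_mkseq leq_max ltnSn.
    have jm : j < m by rewrite leq_max ltnS ltnW.
    by rewrite uv ?size_mkseq // nth_mkseq // su.
  have [mG] := HG (mkseq w m, mkseq w' m); apply.
    split=> [||u u' uw uw' Yu]; [exact: ext|exact: ext|].
    have im : (i.*2.+1).*2 < m by rewrite leq_max ltnSn orbT.
    apply: yi; rewrite -Yw -Yw'; move/(congr1 (@^~ i)): Yu.
    rewrite /Y /sndN /fstN /= uw ?size_mkseq // nth_mkseq //.
    by rewrite uw' ?size_mkseq // nth_mkseq.
  exists x => r; rewrite !inE => /orP[/eqP ->|/orP[/eqP ->|rl]] /=.
  - exists w; split=> //; first exact: cyl_mkseq.
    by apply: HGH; rewrite -{1}Xw.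
  - exists w'; split=> //; first exact: cyl_mkseq.
    by apply: HGH; rewrite -{1}Xw'.
  - have [y0 [z0]] := Pl (index r l); rewrite fstK nth_index // => -[C0 r0 H0].
    have X0 : X (pairN (pairN x y0) z0) = x by rewrite /X !fstK.
    by exists (pairN (pairN x y0) z0); split=> //; apply: HGH; rewrite -{1}X0.
have [h mh Hh] := analytic_function aP fP.
have [|x Hx] := Ls (fun n => if n is n'.+1 then H n' else h).
  by case=> [//|n]; apply: mH.
have av w : avoids (fun n => if n is n'.+1 then H n' else h) x (Y w) ->
  avoids H x (Y w) by move=> Hw n; apply: (Hw n.+1).
have Hx' r : r \in s :: l -> exists y, Q r (pairN x y).
  move=> /Hx[w [Cw rw Xw /av Hw]]; exists (Y w); rewrite -Xw; apply: QP => //.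
  by rewrite Xw.
have [w [Cw sw Xw Hw]] := Hx s (mem_head _ _).
apply: (Hw 0); apply: Hh; split.
  by rewrite -Xw; apply: QP => //; rewrite Xw; apply: av.
move=> k; rewrite fstK; apply: Hx'; rewrite inE.
have [kl|kl] := ltnP k (size l); first by rewrite mem_nth ?orbT.
by rewrite nth_default ?eqxx.
Qed.

(** One level of a splitting tree: every node of l has two incompatible
descendants in l', and l' has no other nodes. *)
Definition refines l l' : Prop :=
  (forall t, t \in l' -> exists2 s, s \in l & extends s t) /\
  (forall s, s \in l -> exists t t', [/\ t \in l', t' \in l',
     extends s t, extends s t' & splits t t']).

Lemma large_refine l m : large (l ++ m) ->
  exists2 l', refines l l' & large (l' ++ m).
Proof.
elim: l m => [|s l IH] m /= Ll; first by exists [::].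
have [t [t' [st st' tt' Lt]]] := large_split Ll.
have [|l' [ref1 ref2] Ll'] := IH ([:: t, t' & m]).
  apply: large_sub Lt => r; rewrite mem_cat !inE.
  by rewrite mem_cat => /orP[->|/orP[->|/orP[->|->]]]; rewrite ?orbT.
exists (t :: t' :: l').
  split=> r; rewrite !inE.
    move=> /orP[/eqP ->|/orP[/eqP ->|/ref1[u ul ur]]].
    + by exists s; rewrite ?mem_head.
    + by exists s; rewrite ?mem_head.
    + by exists u; rewrite ?inE ?ul ?orbT.
  move=> /orP[/eqP ->|/ref2[u [u' [ul ul' ? ? ?]]]].
    by exists t, t'; rewrite !inE !eqxx orbT.
  by exists u, u'; rewrite !inE ul ul' !orbT.
apply: large_sub Ll' => r; rewrite /= !inE !mem_cat !inE.
by move=> /orP[->|/orP[->|/orP[->|->]]]; rewrite ?orbT.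
Qed.

(** Iterating the splitting gives a perfect tree. Its branches are points of C
because C is closed, and they lie above the same x because any two nodes of a
large list contain points above a common x. Given f, the branch avoiding all its
values is found by choosing, at level n, a descendant that avoids f n. *)
Lemma large_section l0 : l0 = [:: [::]] -> large l0 ->
  exists x, forall f : nat -> nat -> nat, exists w,
    [/\ C w, X w = x & forall n, Y w <> f n].
Proof.
move=> l0E L0.
pose R l l' := `[< refines l l' >].
have [T HT] : exists T, forall n,
    large (last l0 (mkseq T n)) /\ path R l0 (mkseq T n).
  apply: (@infinite_branch _ (fun ll => large (last l0 ll) /\ path R l0 ll)).
    by split.
  move=> ll [Ll pll]; have [|l' rl Ll'] := @large_refine (last l0 ll) [::].
    by rewrite cats0.
  rewrite cats0 in Ll'; exists l'; rewrite last_rcons rcons_path pll.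
  by split=> //=; apply/asboolP.
pose L n := last l0 (mkseq T n).
have LL n : large (L n) by case: (HT n).
have LS n : refines (L n) (L n.+1).
  have [_] := HT n.+1; rewrite /L mkseqS rcons_path last_rcons.
  by move=> /andP[_ /asboolP].
have Lsize n s : s \in L n -> n <= size s.
  elim: n s => // n IH s /(LS n).1[t /IH nt [ts _]]; exact: leq_ltn_trans ts.
pose Z w := forall n, exists2 s, s \in L n & cyl s w.
have ZC w : Z w -> C w.
  move=> Zw; apply: cC => n; have [s sL sw] := Zw n.
  have [|x Hx] := LL n (fun=> id); first by move=> ?; exact: measurable_id.
  have [v [Cv sv _ _]] := Hx s sL; exists v => //.
  by apply: agree_le (Lsize _ _ sL) _; exact: cyl_agree.
have ZX w w' : Z w -> Z w' -> X w = X w'.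
  move=> Zw Zw'; apply/funext => i.
  have [s sL sw] := Zw i.*2.*2.+1; have [s' sL' sw'] := Zw' i.*2.*2.+1.
  have [|x Hx] := LL i.*2.*2.+1 (fun=> id); first by move=> ?; exact: measurable_id.
  have [v [_ sv Xv _]] := Hx s sL; have [v' [_ sv' Xv' _]] := Hx s' sL'.
  have Xi r u u' : r \in L i.*2.*2.+1 -> cyl r u -> cyl r u' -> X u i = X u' i.
    by move=> /Lsize ir ru ru'; apply: (cyl_agree ru ru').
  by rewrite (Xi s w v) // (Xi s' w' v') // Xv Xv'.
have Zf (f : nat -> nat -> nat) : exists2 w, Z w & forall n, Y w <> f n.
  have [g Hg] : exists g : nat -> seq nat, forall n, g n \in L n /\
      extends (g n) (g n.+1) /\ (forall w, cyl (g n.+1) w -> Y w <> f n).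
    have step n s : exists t, s \in L n ->
        [/\ t \in L n.+1, extends s t & forall w, cyl t w -> Y w <> f n].
      have [sL|nsL] := pselect (s \in L n); last by exists s.
      have [t [t' [tL tL' st st' tt']]] := (LS n).2 s sL.
      have [Ht|/existsNP[w /not_implyP[tw /contrapT Yw]]] :=
        pselect (forall w, cyl t w -> Y w <> f n); first by exists t.
      by exists t' => _; split=> // w' tw'; rewrite -Yw; apply: nesym; apply: tt'.
    have /choose_fun[G HG] : forall ns : nat * seq nat, exists t, ns.2 \in L ns.1 ->
        [/\ t \in L ns.1.+1, extends ns.2 t & forall w, cyl t w -> Y w <> f ns.1].
      by move=> [n s]; apply: step.
    pose g := fix g n := if n is m.+1 then G (m, g m) else [::].
    have gL n : g n \in L n.
      elim: n => [|n IH]; first by rewrite /L l0E mem_head.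
      by have [] := HG (n, g n) IH.
    by exists g => n; have [] := HG (n, g n) (gL n).
  have gsize n : n <= size (g n) by apply: Lsize; case: (Hg n).
  pose w i := nth 0 (g i.+1) i.
  have gmono n m : n <= m -> forall u, cyl (g m) u -> cyl (g n) u.
    move=> /subnK <-; elim: (m - n) => // k IH u; rewrite addSn => gu.
    by apply: IH; case: (Hg (k + n)) => _ [[_ +] _]; apply.
  have gw n : cyl (g n) w.
    move=> i ig; rewrite /w.
    have pad m : cyl (g m) (nth 0 (g m)) by move=> j.
    have [ni|ni] := leqP n i.+1.
      by rewrite (gmono _ _ ni _ (pad i.+1)).
    by rewrite -(gmono _ _ (ltnW ni) _ (pad n) i (gsize _)).
  exists w; first by move=> n; exists (g n); [case: (Hg n)|].
  by move=> n; case: (Hg n) => _ [_]; apply.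
have [w0 Zw0 _] := Zf (fun=> id).
exists (X w0) => f; have [w Zw Yw] := Zf f; exists w; split=> //; first exact: ZC.
exact: ZX.
Qed.

End LusinNovikovBaire.

Lemma countable_range (T : Type) (A : set T) (t0 : T) :
  countable A -> exists f : nat -> T, A `<=` range f.
Proof.
move=> /countable_injP[g gi].
have /choose_fun[f Hf] : forall n, exists t, forall u, A u -> g u = n -> t = u.
  move=> n; have [[u [Au un]]|nu] := pselect (exists u, A u /\ g u = n).
    by exists u => v Av vn; apply: gi; rewrite ?inE ?un.
  by exists t0 => u Au un; exfalso; apply: nu; exists u.
by exists f => u Au; exists (g u) => //; apply: Hf.
Qed.

(** The theorem of Lusin and Novikov: were a set not covered by countably many
Borel graphs, it would be large, and one of its sections would not be exhausted by
any sequence. *)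
Lemma lusin_novikov_Baire (A : set (nat -> nat)) : analytic A ->
  (forall x, countable [set y | A (pairN x y)]) ->
  exists2 H, borel_family H &
    forall x y, A (pairN x y) -> exists n, y = H n x.
Proof.
move=> [C cC HC] cA.
have nL : ~ large C [:: [::]].
  move=> /(large_section cC erefl)[x Hx].
  have [f Hf] := countable_range (fun=> 0) (cA x).
  have [w [Cw Xw Yw]] := Hx f.
  have /Hf[n _ fn] : [set y | A (pairN x y)] (sndN (fstN w)).
    by rewrite /mkset -Xw pairK; apply/HC; exists (sndN w); rewrite pairK.
  exact: (Yw n).
move/existsNP: nL => [H /not_implyP[mH /forallNP nH]]; exists H => // x y Axy.
apply: contrapT => /forallNP nE; apply: (nH x) => s; rewrite inE => /eqP ->.
have [z Cz] := (HC _).1 Axy.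
by exists (pairN (pairN x y) z); split=> //; rewrite !fstK ?sndK.
Qed.

(** * Standard Borel spaces as Borel retracts of Baire space *)

(** Standard Borel spaces enter the proofs only through this property: they are
Borel retracts of Baire space. *)
Definition coded d (T : measurableType d) : Prop :=
  exists (e : T -> Baire) (c : Baire -> T),
    [/\ measurable_fun setT e, measurable_fun setT c & cancel e c].

Section Polish.
Import Order.TTheory GRing.Theory Num.Theory.
Local Open Scope ring_scope.
Context (F : realType) (P : completePseudoMetricType F).
Hypotheses (hP : hausdorff_space P) (scP : @second_countable P).

Let r (k : nat) : F := k.+1%:R^-1.

Let r_gt0 k : 0 < r k. Proof. by rewrite invr_gt0 ltr0n. Qed.

Let r_le k l : (k <= l)%N -> r l <= r k.
Proof. by move=> kl; rewrite lef_pV2 ?posrE ?ltr0n // ler_nat. Qed.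

Let r_small (eps : F) : 0 < eps -> exists k, r k < eps.
Proof.
by move=> e0; have [k _ Hk] := near_infty_natSinv_lt (PosNum e0); exists k; apply: Hk => /=.
Qed.

Let dense_seq : exists q : nat -> P, forall p (eps : F), 0 < eps ->
  exists i, ball p eps (q i).
Proof.
have [B cB [Bopen Bnbhs]] := scP.
have [U BU] := countable_range set0 cB.
have /choose_fun[q Hq] : forall n, exists x : P, U n !=set0 -> U n x.
  by move=> n; have [[x Ux]|nU] := pselect (U n !=set0); [exists x|exists point].
exists q => p eps e0.
have [V [BV Vp] Vb] := Bnbhs p _ (nbhsx_ballx p eps e0).
have [n _ Un] := BU _ BV; exists n; apply: Vb.
by rewrite -Un; apply: Hq; rewrite Un; exists p.
Qed.

Let complete_seq (u : nat -> P) :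
  (forall k l, (k <= l)%N -> ball (u k) (r k + r k) (u l)) ->
  exists p, forall k, ball (u k) (r k + r k + r k) p.
Proof.
move=> Hu.
have /cauchy_cvg : cauchy (u @ \oo).
  apply: cauchy_exP => eps e0.
  have [k rk] := r_small (divr_gt0 e0 (ltr0n F 2)).
  exists (u k); exists k => // l /= kl.
  apply: le_ball (Hu _ _ kl); rewrite [leRHS](splitr eps).
  by apply: lerD; exact: ltW.
move=> /cvg_ex[p up]; exists p => k.
have [N _ HN] := up _ (nbhsx_ballx p _ (r_gt0 k)).
apply: (@ball_triangle _ _ (u (maxn k N))); first by apply: Hu; exact: leq_maxl.
by apply: ball_sym; apply: HN; exact: leq_maxr.
Qed.

Let ball_eq (p p' : P) : (forall eps : F, 0 < eps -> ball p eps p') -> p = p'.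
Proof.
move=> H; apply: hP => A B /nbhs_ballP[eps e0 pA] /nbhs_ballP[eps' e0' pB].
by exists p'; split; [apply: pA; exact: H|apply: pB; exact: ballxx].
Qed.

(** A point is coded by the list of the small balls around a dense sequence that
contain it; a code is read by taking the limit of the first centres it names,
whenever they form a fast Cauchy sequence. *)
Lemma polish_code : exists (e : P -> Baire) (c : Baire -> P),
  [/\ forall i k, <<s @open P >> [set p | e p i = k],
      forall B, <<s @open P >> B -> measurable (c @^-1` B) & cancel e c].
Proof.
have [q Hq] := dense_seq.
(* Balls need not be open, hence the interiors. *)
pose O (j : nat) : set P :=
  if unpickle j is Some (k, i) then interior (ball (q i) (r k)) else set0.
pose e (p : P) : Baire := fun j => if `[< O j p >] then 1%N else 0%N.
(* The centre of radius r k named by the code x is the least i that x marks, and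
0 if x marks none. *)
pose first (x : Baire) (k i : nat) := x (pickle (k, i)) = 1%N /\
  forall j, (j < i)%N -> x (pickle (k, j)) <> 1%N.
pose ctr (x : Baire) (k i : nat) := first x k i \/ (i = 0%N /\ forall j, ~ first x k j).
have ctr_uniq x k i j : ctr x k i -> ctr x k j -> i = j.
  have fu i' j' : first x k i' -> first x k j' -> i' = j'.
    move=> [xi ni] [xj nj]; case: (ltngtP i' j') => // ij.
      by case: (nj _ ij xi).
    by case: (ni _ ij xj).
  by move=> [fi|[-> ni]] [fj|[-> nj]] //; [exact: fu|case: (nj _ fi)|case: (ni _ fj)].
have /choose_fun[I HI] : forall x : Baire, exists i : nat -> nat,
    forall k, ctr x k (i k).
  move=> x; suff /choose_fun[i Hi] : forall k, exists i, ctr x k i by exists i.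
  move=> k; have [[i fi]|/forallNP nf] := pselect (exists i, first x k i).
    by exists i; left.
  by exists 0%N; right.
have mI k i : @mbor _ Baire setT (fun x => I x k = i).
  apply: (@mbor_ext _ Baire _ (fun x => ctr x k i)) => [x _|].
    by split=> [ci|<-//]; apply: ctr_uniq (HI x k) ci.
  have mf j : @mbor _ Baire setT (fun x => first x k j).
    apply: (mbor_and measurableT); first by rewrite mborT; exact: measurable_coord.
    apply: (mbor_all measurableT) => l.
    apply: (mbor_imp measurableT); first exact: (mbor_const measurableT).
    by apply: (mbor_not measurableT); rewrite mborT; exact: measurable_coord.
  apply: (mbor_or measurableT) => //.
  apply: (mbor_and measurableT); first exact: (mbor_const measurableT).
  by apply: (mbor_all measurableT) => j; apply: (mbor_not measurableT).
pose good x := forall k l, (k <= l)%N -> ball (q (I x k)) (r k + r k) (q (I x l)).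
have /choose_fun[c Hc] : forall x : Baire, exists p : P,
    (good x -> forall k, ball (q (I x k)) (r k + r k + r k) p) /\
    (~ good x -> p = point).
  move=> x; have [gx|ngx] := pselect (good x); last by exists point.
  by have [p Hp] := complete_seq gx; exists p.
have mP k (Q : nat -> Prop) : @mbor _ Baire setT (fun x => Q (I x k)).
  apply: (@mbor_ext _ Baire _ (fun x => exists i, Q i /\ I x k = i)) => [x _|].
    by split=> [[i [Qi ->]]|Qi] //; exists (I x k).
  apply: (mbor_ex measurableT) => i.
  by apply: (mbor_and measurableT); first exact: (mbor_const measurableT).
have mgood : @mbor _ Baire setT good.
  apply: (mbor_all measurableT) => k; apply: (mbor_all measurableT) => l.
  apply: (mbor_imp measurableT); first exact: (mbor_const measurableT).
  apply: (@mbor_ext _ Baire _ (fun x => exists i,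
      I x k = i /\ ball (q i) (r k + r k) (q (I x l)))) => [x _|].
    by split=> [[i [-> ?]]|?] //; exists (I x k).
  apply: (mbor_ex measurableT) => i; apply: (mbor_and measurableT) => //.
  exact: (mP l (fun j => ball (q i) (r k + r k) (q j))).
exists e, c; split.
- move=> j k; have sO : <<s @open P >> (O j).
    rewrite /O; case: (unpickle j) => [[k' i]|]; last exact: sigma_algebra0.
    by apply: sub_sigma_algebra; exact: open_interior.
  have [k0|k1|k2] : [\/ k = 0%N, k = 1%N | (1 < k)%N].
    by case: k => [|[|k]]; [exact: Or31|exact: Or32|exact: Or33].
  + suff -> : [set p | e p j = k] = ~` O j by rewrite -setTD; exact: sigma_algebraCD.
    apply/seteqP; split=> p; rewrite /mkset /e k0; case: asboolP => //.
  + suff -> : [set p | e p j = k] = O j by [].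
    apply/seteqP; split=> p; rewrite /mkset /e k1; case: asboolP => //.
  + suff -> : [set p | e p j = k] = set0 by exact: sigma_algebra0.
    by rewrite -subset0 => p /=; rewrite /e => ek; move: k2; rewrite -ek; case: ifP.
- move=> B; suff mc : measurable_fun setT (c : Baire -> g_sigma_algebraType (@open P)).
    by move=> sB; rewrite -[X in measurable X]setTI; apply: mc.
  apply: (@measurability _ _ Baire (g_sigma_algebraType (@open P)) setT c
    (@open P) erefl).
  move=> _ [V oV <-]; apply: (@mbor_ext _ Baire _ (fun x => (good x /\ exists k,
     ball (q (I x k)) (r k + r k + r k) `<=` V) \/ (~ good x /\ V point))) => [x _|].
    split=> [[[gx [k kV]]|[ngx Vp]]|Vc].
    + by apply: kV; apply: (Hc x).1.
    + by rewrite /preimage/= (Hc x).2.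
    have [gx|ngx] := pselect (good x); last first.
      by right; split=> //; rewrite -((Hc x).2 ngx).
    left; split=> //.
    have /nbhs_ballP[eps /= e0 epsV] : nbhs (c x) V by exact: open_nbhs_nbhs.
    (* Two points within 3 r k of the same centre are within 6 r k < eps. *)
    have [k rk] := r_small (divr_gt0 e0 (ltr0n F 6)).
    exists k => p kp; apply: epsV.
    have [{}Hc _] := Hc x.
    have := ball_triangle (ball_sym (Hc gx k)) kp; apply: le_ball.
    have -> : eps = eps / 6 + eps / 6 + eps / 6 + (eps / 6 + eps / 6 + eps / 6).
      by rewrite -!mulrDl -[in LHS](@mulfK _ 6 _ eps) ?pnatr_eq0 //; congr (_ / _); ring.
    by rewrite !lerD// ltW.
  apply: (mbor_or measurableT); apply: (mbor_and measurableT) => //.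
  + apply: (mbor_ex measurableT) => k.
    exact: (mP k (fun i => ball (q i) (r k + r k + r k) `<=` V)).
  + by apply: (mbor_not measurableT).
  + exact: (mbor_const measurableT).
- move=> p.
  have near k : ball (q (I (e p) k)) (r k) p.
    have codeP i : e p (pickle (k, i)) = 1%N <-> interior (ball (q i) (r k)) p.
      by rewrite /e /O pickleK; split; case: asboolP.
    have [i Hi] : exists i, interior (ball (q i) (r k)) p.
      have [i Hi] := Hq p _ (divr_gt0 (r_gt0 k) (ltr0n F 2)).
      exists i; apply/nbhs_ballP; exists (r k / 2) => /=.
        by rewrite divr_gt0 ?r_gt0 ?ltr0n.
      move=> p' pp'; rewrite (splitr (r k)); apply: ball_triangle pp'.
      exact: ball_sym.
    case: (HI (e p) k) => [[/codeP /interior_subset//]|[_ nf]].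
    exfalso; have [m /codeP em mmin] : exists2 m, interior (ball (q m) (r k)) p &
        forall j, (j < m)%N -> ~ interior (ball (q j) (r k)) p.
      have ex : exists i, `[< interior (ball (q i) (r k)) p >].
        by exists i; apply/asboolP.
      exists (ex_minn ex); first by case: ex_minnP => m /asboolP.
      by case: ex_minnP => m _ mmin j jm /asboolP /mmin; rewrite leqNgt jm.
    by apply: (nf m); split=> // j /mmin nj /codeP.
  have gp : good (e p).
    move=> k l kl; apply: (@ball_triangle _ _ p); first exact: near.
    by apply: ball_sym; apply: le_ball (near l); exact: r_le.
  apply/esym/ball_eq => eps e0.
  have [k rk] := r_small (divr_gt0 e0 (ltr0n F 4)).
  have := ball_triangle (ball_sym (near k)) ((Hc (e p)).1 gp k); apply: le_ball.
  have -> : eps = eps / 4 + (eps / 4 + eps / 4 + eps / 4).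
    by rewrite -!mulrDl -[in LHS](@mulfK _ 4 _ eps) ?pnatr_eq0 //; congr (_ / _); ring.
  by rewrite !lerD// ltW.
Qed.

End Polish.

Lemma standard_coded (F : realType) d (T : measurableType d) :
  standard_borel F T -> coded T.
Proof.
move=> [P [f [hP scP bf Hf]]].
have [e [c [me mc ec]]] := polish_code hP scP.
have [g fK gK] := bf.
exists (e \o f), (g \o c); split.
- apply: measurable_Baire => // i k; rewrite mborT; apply/Hf.
  suff -> : f @` [set x | (e \o f) x i = k] = [set p | e p i = k] by [].
  apply/seteqP; split=> [_ [x /= ex <-]//|p /= ep].
  by exists (g p); rewrite /= gK.
- move=> _ B /Hf /mc; rewrite setTI.
  suff -> : (g \o c) @^-1` B = c @^-1` (f @` B) by [].
  apply/seteqP; split=> x /=; first by exists (g (c x)).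
  by move=> [t Bt tx]; rewrite -tx fK.
- by move=> t; rewrite /= ec fK.
Qed.

(** * Borel sets with countable sections, products of standard Borel spaces *)

Lemma mbor_eq d1 d2 (T1 : measurableType d1) (T2 : measurableType d2)
    (D : set T1) (f g : T1 -> T2) : coded T2 -> measurable D ->
  measurable_fun D f -> measurable_fun D g -> mbor D (fun x => f x = g x).
Proof.
move=> [e [c [me mc ec]]] mD mf mg.
apply: (@mbor_ext _ T1 _ (fun x => forall i, exists k,
    (e \o f) x i = k /\ (e \o g) x i = k)) => [x _|].
  split=> [H|fg i]; last by exists (e (f x) i); rewrite /= fg.
  apply: (can_inj ec); apply/funext => i.
  by have [k [/= -> <-]] := H i.
apply: (mbor_all mD) => i; apply: (mbor_ex mD) => k; apply: (mbor_and mD);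
  by apply: mbor_coord => //; apply: measurableT_comp.
Qed.

(** The theorem of Lusin and Novikov is transported from Baire space through codes
of the two factors; since the code of Y has a Borel left inverse defined
everywhere, the functions h n are total. *)
Lemma lusin_novikov d1 d2 (X : measurableType d1) (Y : measurableType d2)
    (C : set (X * Y)) : coded X -> coded Y -> measurable C ->
  (forall x, countable [set y | C (x, y)]) ->
  exists h : nat -> X -> Y, (forall n, measurable_fun setT (h n)) /\
    forall x y, C (x, y) -> exists n, y = h n x.
Proof.
move=> [e [c [me mc ec]]] [e' [c' [me' mc' ec']]] mC cC.
have mfst : measurable_fun setT (c \o (fstN : Baire -> Baire)).
  by apply: measurableT_comp => //; exact: measurable_fstN.
have msnd : measurable_fun setT (c' \o (sndN : Baire -> Baire)).
  by apply: measurableT_comp => //; exact: measurable_sndN.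
(* Pairs of codes; the second condition keeps a single code for each y, so that
the sections stay countable. *)
pose A := [set v : Baire | C (c (fstN v), c' (sndN v)) /\
  e' (c' (sndN v)) = sndN v].
have mA : measurable A.
  rewrite -mborT; apply: (mbor_and measurableT).
    apply: (@mbor_comp _ _ Baire (X * Y)%type setT
      (fun v => ((c \o fstN) v, (c' \o sndN) v))) => //.
    exact: measurable_fun_pair.
  apply: (@mbor_eq _ _ Baire Baire setT (e' \o (c' \o sndN)) sndN) => //.
  - by exists id, id; split=> //; exact: measurable_id.
  - exact: measurableT_comp.
  - exact: measurable_sndN.
have [H mH HA] : exists2 H, borel_family H &
    forall x y, A (pairN x y) -> exists n, y = H n x.
  apply: lusin_novikov_Baire; first exact: analytic_measurable.
  move=> x; apply: sub_countable (cC (c x)).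
  apply: card_le_trans (card_image_le e' _).
  apply: subset_card_le => y [/=]; rewrite fstK sndK => Cy ey.
  by exists (c' y).
exists (fun n => c' \o (H n \o e)); split.
  by move=> n; do 2! apply: measurableT_comp => //; exact: mH.
move=> x y Cxy; have [|n Hn] := HA (e x) (e' y).
  by split; rewrite /mkset ?fstK ?sndK ?ec ?ec'.
by exists n; rewrite /= -Hn ec'.
Qed.

HB.saturate prod.

Section Product.
Local Open Scope ring_scope.

Section Complete.
Context (F : realType) (P Q : completePseudoMetricType F).

Let prod_complete (G : set_system (P * Q)) : ProperFilter G -> cauchy G -> cvg G.
Proof.
move=> PG cG.
have /cauchy_cvg/cvg_ex[p Gp] : cauchy (fst @ G).
  apply: cauchy_exP => eps e0.
  have [[x y] Gxy] := (cauchyP G).1 cG eps e0; exists x.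
  suff: G (fst @^-1` ball x eps) by [].
  by apply: filterS Gxy => z [].
have /cauchy_cvg/cvg_ex[q Gq] : cauchy (snd @ G).
  apply: cauchy_exP => eps e0.
  have [[x y] Gxy] := (cauchyP G).1 cG eps e0; exists y.
  suff: G (snd @^-1` ball y eps) by [].
  by apply: filterS Gxy => z [].
apply/cvg_ex; exists (p, q) => A [[B B'] [/= pB qB'] BA].
have GB : G (fst @^-1` B) := Gp _ pB.
have GB' : G (snd @^-1` B') := Gq _ qB'.
suff : G A by [].
apply: filterS (filterI GB GB') => -[x y] [/= Bx By]; exact: BA.
Qed.

HB.instance Definition _ := Uniform_isComplete.Build (P * Q)%type prod_complete.

End Complete.

Lemma prod_hausdorff (T U : topologicalType) :
  hausdorff_space T -> hausdorff_space U -> hausdorff_space (T * U)%type.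
Proof.
move=> hT hU [x y] [x' y'] cl; congr pair.
  apply: hT => A B xA xB.
  have [||[a b] [/= ]] := cl (fst @^-1` A) (fst @^-1` B).
  - by exists (A, setT) => [|[? ?] []] //=; split=> //; exact: filterT.
  - by exists (B, setT) => [|[? ?] []] //=; split=> //; exact: filterT.
  - by exists a.
apply: hU => A B xA xB.
have [||[a b] [/= ]] := cl (snd @^-1` A) (snd @^-1` B).
- by exists (setT, A) => [|[? ?] []] //=; split=> //; exact: filterT.
- by exists (setT, B) => [|[? ?] []] //=; split=> //; exact: filterT.
- by exists b.
Qed.

Lemma prod_basis (T U : topologicalType) (B : set (set T)) (C : set (set U)) :
  basis B -> basis C -> basis [set V `*` W | V in B & W in C].
Proof.
move=> [oB bB] [oC bC]; split.
  move=> _ [V BV [W CW <-]]; rewrite openE => -[x y] [/= Vx Wy].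
  exists (V, W) => //=; split; apply: open_nbhs_nbhs; split=> //.
    exact: oB.
  exact: oC.
move=> [x y] A [[A1 A2] [/= xA1 yA2] A12].
have [V [BV Vx] VA] := bB x _ xA1; have [W [CW Wy] WA] := bC y _ yA2.
exists (V `*` W); first by split=> //; exists V => //; exists W.
by move=> [a b] [/= ? ?]; apply: A12; split; [exact: VA|exact: WA].
Qed.

Lemma prod_second_countable (T U : topologicalType) :
  @second_countable T -> @second_countable U -> @second_countable (T * U)%type.
Proof.
move=> [B cB bB] [C cC bC]; exists [set V `*` W | V in B & W in C]; last exact: prod_basis.
have [f Bf] := countable_range set0 cB; have [g Cg] := countable_range set0 cC.
apply: (@sub_countable _ _ _ [set f n.1 `*` g n.2 | n in [set: nat * nat]]).
  apply: subset_card_le => _ [V /Bf[n _ <-] [W /Cg[m _ <-] <-]].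
  by exists (n, m).
by apply: sub_countable (card_image_le _ _) _; exact: countableP.
Qed.

Lemma standard_borel_prod (F : realType) d1 d2 (T : measurableType d1)
    (U : measurableType d2) :
  standard_borel F T -> standard_borel F U -> standard_borel F (T * U)%type.
Proof.
move=> [P [f [hP scP [f' fK f'K] Hf]]] [Q [g [hQ scQ [g' gK g'K] Hg]]].
pose h (x : T * U) : P * Q := (f x.1, g x.2).
exists (P * Q)%type, h; split.
- exact: prod_hausdorff.
- exact: prod_second_countable.
- by exists (fun x => (f' x.1, g' x.2)) => -[x y]; rewrite /h /= ?fK ?gK ?f'K ?g'K.
pose h' (x : P * Q) : T * U := (f' x.1, g' x.2).
have hK : cancel h h' by move=> [x y]; rewrite /h /h' /= fK gK.
have h'K : cancel h' h by move=> [x y]; rewrite /h /h' /= f'K g'K.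
have himg B : h @` B = h' @^-1` B.
  apply/seteqP; split=> [_ [x Bx <-]|x /= Bx]; first by rewrite /= hK.
  by exists (h' x).
move=> B; rewrite himg; split=> [mB|].
  suff : measurable_fun setT (h' : g_sigma_algebraType (@open (P * Q)%type) -> T * U).
    by move=> /(_ measurableT _ mB); rewrite setTI.
  have mf' : measurable_fun setT (fun x : g_sigma_algebraType (@open (P * Q)%type) => f' x.1).
    move=> _ A /Hf; rewrite setTI.
    have -> : f @` A = f' @^-1` A.
      apply/seteqP; split=> [_ [x Ax <-]|x /= Ax]; first by rewrite /= fK.
      by exists (f' x).
    suff mfst : measurable_fun setT
        (fst : g_sigma_algebraType (@open (P * Q)%type) -> g_sigma_algebraType (@open P)).
      by move=> /(mfst measurableT); rewrite setTI.
    apply: (@measurability _ _ (g_sigma_algebraType (@open (P * Q)%type))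
      (g_sigma_algebraType (@open P)) setT fst (@open P) erefl).
    move=> _ [V oV <-]; rewrite setTI; apply: sub_sigma_algebra.
    by apply: open_comp => // ? _; exact: cvg_fst.
  have mg' : measurable_fun setT (fun x : g_sigma_algebraType (@open (P * Q)%type) => g' x.2).
    move=> _ A /Hg; rewrite setTI.
    have -> : g @` A = g' @^-1` A.
      apply/seteqP; split=> [_ [x Ax <-]|x /= Ax]; first by rewrite /= gK.
      by exists (g' x).
    suff msnd : measurable_fun setT
        (snd : g_sigma_algebraType (@open (P * Q)%type) -> g_sigma_algebraType (@open Q)).
      by move=> /(msnd measurableT); rewrite setTI.
    apply: (@measurability _ _ (g_sigma_algebraType (@open (P * Q)%type))
      (g_sigma_algebraType (@open Q)) setT snd (@open Q) erefl).
    move=> _ [V oV <-]; rewrite setTI; apply: sub_sigma_algebra.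
    by apply: open_comp => // ? _; exact: cvg_snd.
  exact: measurable_fun_pair.
suff mh : measurable_fun setT (h : T * U -> g_sigma_algebraType (@open (P * Q)%type)).
  move=> /(mh measurableT); rewrite setTI => mB.
  suff -> : B = h @^-1` (h' @^-1` B) by [].
  by apply/seteqP; split=> x /=; rewrite hK.
apply: (@measurability _ _ _ (g_sigma_algebraType (@open (P * Q)%type)) setT h
  (@open (P * Q)%type) erefl).
move=> _ [V oV <-]; rewrite setTI.
have [B' cB [oB bB]] := scP; have [C' cC [oC bC]] := scQ.
have [b Bb] := countable_range set0 cB; have [c Cc] := countable_range set0 cC.
rewrite -mborT; apply: (@mbor_ext _ _ setT (fun x => exists n m,
    [/\ B' (b n), C' (c m) & b n `*` c m `<=` V] /\ (b n (f x.1) /\ c m (g x.2)))).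
  move=> x _; split=> [[n [m [[_ _ nm] [? ?]]]]|Vx]; first exact: nm.
  have := oV; rewrite openE => /(_ _ Vx) [[A1 A2] [/= xA1 yA2] A12].
  have [W [BW Wx] WA] := bB _ _ xA1; have [Z [CZ Zy] ZA] := bC _ _ yA2.
  have [n _ bn] := Bb _ BW; have [m _ cm] := Cc _ CZ.
  exists n, m; rewrite bn cm; split=> //; split=> // -[p q] [/= Wp Zq].
  by apply: A12; split; [exact: WA|exact: ZA].
apply: (mbor_ex measurableT) => n; apply: (mbor_ex measurableT) => m.
have [[Bn Cm bcV]|nH] := pselect [/\ B' (b n), C' (c m) & b n `*` c m `<=` V]; last first.
  by apply: (@mbor_ext _ _ setT (fun=> False)); [move=> x _; split=> // -[]|
    exact: (mbor_const measurableT)].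
apply: (mbor_and measurableT); first exact: (mbor_const measurableT).
apply: (mbor_and measurableT); rewrite mborT.
  suff -> : [set x : T * U | b n (f x.1)] = (f @^-1` b n) `*` setT.
    apply: measurableX => //; apply/Hf; apply: sub_sigma_algebra.
    suff -> : f @` (f @^-1` b n) = b n by exact: oB.
    by apply/seteqP; split=> [_ [x ? <-]//|p bp]; exists (f' p) => //=; rewrite f'K.
  by apply/seteqP; split=> x //= [].
suff -> : [set x : T * U | c m (g x.2)] = setT `*` (g @^-1` c m).
  apply: measurableX => //; apply/Hg; apply: sub_sigma_algebra.
  suff -> : g @` (g @^-1` c m) = c m by exact: oC.
  by apply/seteqP; split=> [_ [x ? <-]//|p bp]; exists (g' p) => //=; rewrite g'K.
by apply/seteqP; split=> x //= [].
Qed.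

End Product.

(** * Borel enumerations of countable R-sets *)

(** Countable choice made measurable: among countably many partial functions,
each point uses the first one defined there. *)
Lemma first_choice d1 d2 (T : measurableType d1) (U : measurableType d2)
    (D : nat -> set T) (f : nat -> T -> U) :
  (forall j, measurable (D j)) -> (forall j, measurable_fun (D j) (f j)) ->
  exists2 g : T -> U, measurable_fun (\bigcup_j D j) g &
    forall x, (exists j, D j x) ->
      exists j, [/\ D j x, g x = f j x & forall i, i < j -> ~ D i x].
Proof.
move=> mD mf.
have /choose_fun[g Hg] : forall x, exists y : U, (exists j, D j x) ->
    exists j, [/\ D j x, y = f j x & forall i, i < j -> ~ D i x].
  move=> x; have [[j0 Dj0]|nD] := pselect (exists j, D j x); last first.
    by exists point => /nD.
  have ex : exists j, `[< D j x >] by exists j0; apply/asboolP.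
  case: (ex_minnP ex) => j /asboolP Dj jmin; exists (f j x) => _.
  by exists j; split=> // i ij /asboolP /jmin; rewrite leqNgt ij.
exists g => // mDU B mB.
have -> : \bigcup_j D j `&` g @^-1` B =
    \bigcup_j ((D j `&` f j @^-1` B) `\` \bigcup_(i < j) D i).
  apply/seteqP; split=> x.
    move=> [[j0 _ Dj0] Bx]; have [|j [Dj gx jmin]] := Hg x; first by exists j0.
    exists j => //; split; first by split=> //; rewrite /preimage /= -gx.
    by move=> [i /= ij Di]; apply: jmin Di.
  move=> [j _ [[Dj Bj] nj]]; split; first by exists j.
  have [|k [Dk gx kmin]] := Hg x; first by exists j.
  have -> : g @^-1` B = [set x | B (g x)] by [].
  rewrite /mkset gx; suff -> : k = j by [].
  case: (ltngtP k j) => // [kj|jk]; first by case: nj; exists k.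
  by case: (kmin j jk).
apply: bigcupT_measurable => j; apply: measurableD; first exact: mf.
by apply: bigcup_measurable => i _.
Qed.

Lemma measurable_pairD d d1 d2 (T : measurableType d) (T1 : measurableType d1)
    (T2 : measurableType d2) (D : set T) (f : T -> T1) (g : T -> T2) :
  measurable_fun D f -> measurable_fun D g ->
  measurable_fun D (fun x => (f x, g x)).
Proof.
move=> mf mg mD.
apply: (measurability _ (measurable_prod_measurableType T1 T2)) => //.
move=> _ [_ [B mB [C mC <-]] <-].
suff -> : D `&` (fun x => (f x, g x)) @^-1` (B `*` C) =
  (D `&` f @^-1` B) `&` (D `&` g @^-1` C).
  by apply: measurableI; [exact: mf|exact: mg].
by apply/seteqP; split=> x; [move=> [? []]|move=> [[? ?] []]].
Qed.

Section RSpaceFacts.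
Context (F : realType) d (X : measurableType d) (R : set (X * X)) (A : set X).
Context (sX : standard_borel F X) (mR : measurable R).
Implicit Types Y : rspace F R A.

Lemma rset_enumeration Y : countable_rset Y ->
  exists h : nat -> X -> Y, (forall n, measurable_fun setT (h n)) /\
    forall v, carrier Y v -> exists n, v = h n (proj Y v).
Proof.
move=> cY; pose C := [set xv : X * Y | carrier Y xv.2 /\ proj Y xv.2 = xv.1].
have [||||h [mh Ch]] := @lusin_novikov _ _ X Y C.
- exact: standard_coded sX.
- exact: standard_coded (rs_standard Y).
- have mC : measurable (setT `*` carrier Y : set (X * Y)).
    by apply: measurableX => //; exact: carrier_measurable.
  have := @mbor_eq _ _ (X * Y)%type X (setT `*` carrier Y) (proj Y \o snd) fst
    (standard_coded sX) mC.
  suff -> : C = (setT `*` carrier Y) `&` [set x | (proj Y \o snd) x = x.1].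
    apply.
      apply: (measurable_comp (carrier_measurable Y)) => //.
      - by move=> _ [[x v] [_ /= Yv] <-].
      - exact: proj_measurable.
      - exact: measurable_funTS measurable_snd.
    exact: measurable_funTS measurable_fst.
  by apply/seteqP; split=> [[x v] [/= ? ?]|[x v] [[_ /= ?] ?]].
- move=> x; have := cY x; suff -> : fiber Y x = [set v | C (x, v)] by [].
  by apply/seteqP; split.
exists h; split=> // v Yv; exact: Ch.
Qed.

Lemma measurable_act Y d' (T : measurableType d') (D : set T) (f : T -> X) (g : T -> Y) :
  measurable_fun D f -> measurable_fun D g ->
  (forall t, D t -> carrier Y (g t) /\ R (f t, proj Y (g t))) ->
  measurable_fun D (fun t => act Y (f t) (g t)).
Proof.
move=> mf mg Dfg.
pose G := [set xv : X * Y | carrier Y xv.2 /\ R (xv.1, proj Y xv.2)].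
have mG : measurable G.
  have mC : measurable (setT `*` carrier Y : set (X * Y)).
    by apply: measurableX => //; exact: carrier_measurable.
  have mp : measurable_fun (setT `*` carrier Y : set (X * Y))
      (fun xv : X * Y => (xv.1, proj Y xv.2)).
    apply: measurable_pairD => /=.
      exact: measurable_funTS measurable_fst.
    apply: (measurable_comp (carrier_measurable Y)) => //.
    - by move=> _ [[x v] [_ /= Yv] <-].
    - exact: proj_measurable.
    - exact: measurable_funTS measurable_snd.
  suff -> : G = (setT `*` carrier Y) `&` (fun xv : X * Y => (xv.1, proj Y xv.2)) @^-1` R.
    exact: mp.
  by apply/seteqP; split=> [[x v] [/= ? ?]|[x v] [[_ /= ?] ?]].
apply: (measurable_comp (f := fun xv : X * Y => act Y xv.1 xv.2)
  (g := fun t => (f t, g t)) mG) => //.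
- by move=> _ [t Dt <-]; exact: Dfg.
- exact: act_measurable.
- exact: measurable_pairD.
Qed.

End RSpaceFacts.

(** * Contracting an R-tree onto its base space *)

Section Contraction.
Context (F : realType) d (X : measurableType d) (R : set (X * X)) (A A' : set X).
Context (T : rtree F R A).
Hypotheses (sX : standard_borel F X) (bR : borel_equiv_rel R).
Hypotheses (mA' : measurable A') (iA' : invariant R A') (A'A : A' `<=` A).

Local Notation VT := (vertices T).
Local Notation ET := (edges T).
Local Notation s := (@src _ _ _ _ _ T).
Local Notation r := (@rng _ _ _ _ _ T).

Let mR : measurable R. Proof. by case: bR. Qed.
Let Rrefl x : R (x, x). Proof. by case: bR => _ []. Qed.
Let Rsym x y : R (x, y) -> R (y, x). Proof. by case: bR => _ [_ + _]; apply. Qed.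
Let Rtrans x y z : R (x, y) -> R (y, z) -> R (x, z).
Proof. by case: bR => _ [_ _]; apply. Qed.

Definition over : set VT := carrier VT `&` proj VT @^-1` A'.

Context (pi : VT -> X).
Hypotheses (mpi : measurable_fun over pi).
Hypotheses (piR : forall v, over v -> R (pi v, proj VT v)).
Hypotheses (pi_act : forall x v, over v -> R (x, proj VT v) ->
  pi (act VT x v) = pi v).

Let m_over : measurable over.
Proof.
exact: (proj_measurable (carrier_measurable VT) mA').
Qed.

Lemma over_act x v : over v -> R (x, proj VT v) -> over (act VT x v).
Proof.
move=> [Cv Av] Rx; split; first exact: act_carrier.
by rewrite /preimage /= act_proj //; apply: iA' Rx Av.
Qed.

Let Api v : over v -> A' (pi v).
Proof. by move=> Ov; apply: iA' (piR Ov) _; case: Ov. Qed.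

(** The point of the orbit of v that lies over pi v. Whatever is computed from
[base v] is automatically invariant under the action, which is how all the
choices below are made equivariant. *)
Definition base v : VT := act VT (pi v) v.

Let base_over v : over v -> over (base v).
Proof. by move=> Ov; apply: over_act => //; exact: piR. Qed.

Let base_proj v : over v -> proj VT (base v) = pi v.
Proof. by move=> Ov; rewrite act_proj //; [case: Ov|exact: piR]. Qed.

Let pi_base v : over v -> pi (base v) = pi v.
Proof. by move=> Ov; rewrite pi_act //; exact: piR. Qed.

Let base_act x v : over v -> R (x, proj VT v) -> base (act VT x v) = base v.
Proof.
move=> Ov Rx; rewrite /base pi_act // act_comp //; first by case: Ov.
exact: Rtrans (piR Ov) (Rsym Rx).
Qed.

Let act_base x v : over v -> R (x, proj VT v) -> act VT x (base v) = act VT x v.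
Proof.
move=> Ov Rx; rewrite /base act_comp //; first by case: Ov.
  exact: Rtrans Rx (Rsym (piR Ov)).
exact: piR.
Qed.

Let m_base : measurable_fun over base.
Proof.
apply: (measurable_act mR); [exact: mpi|exact: measurable_id|].
by move=> v Ov; split; [case: Ov|exact: piR].
Qed.

Lemma edge_ends e : carrier ET e ->
  fiber VT (proj ET e) (s e) /\ fiber VT (proj ET e) (r e).
Proof.
move=> Ce; have [[_ _ +] _ _] := fiber_tree T (proj_base Ce).
by move=> /(_ e); apply.
Qed.

Lemma edge_act x e : carrier ET e -> R (x, proj ET e) ->
  [/\ fiber ET x (act ET x e), s (act ET x e) = act VT x (s e) &
      r (act ET x e) = act VT x (r e)].
Proof.
move=> Ce Rx; split; [|exact: src_act|exact: rng_act].
by split; [exact: act_carrier|exact: act_proj].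
Qed.

Lemma edge_over x e : A' x -> fiber ET x e ->
  [/\ over (s e), over (r e), proj VT (s e) = x & proj VT (r e) = x].
Proof.
move=> Ax [Ce ex]; have [[Cs sx] [Cr rx]] := edge_ends Ce.
by split; rewrite ?sx ?rx ?ex //; split; rewrite // /preimage /= ?sx ?rx ex.
Qed.

(** The set Q consists of the values of pi, tau z is a vertex kept as the centre
of z, and rho sends a vertex to the point whose block contains it. The blocks are
grown from the centres: at each stage, a vertex of the domain L of rho passes its
value to its neighbours outside L, and a vertex with several such neighbours uses
the first edge, for the enumeration over its base point, that leads into L.
Since T is connected, every vertex is reached.

The last clause says that a block is connected, in the only form in which this is
used: a property of vertices that no edge inside a block can change is constant
on the block. *)
Lemma contraction : exists (Q : set X) (tau : X -> VT) (rho : VT -> X),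
  [/\ [/\ measurable Q, Q `<=` A',
       forall x, Q x -> fiber VT x (tau x) & forall v, over v -> Q (pi v)],
      [/\ measurable_fun over rho,
       forall v, over v -> R (rho v, proj VT v) /\ Q (rho v),
       forall x v, over v -> R (x, proj VT v) -> rho (act VT x v) = rho v &
       forall x z, A' x -> R (x, z) -> Q z -> rho (act VT x (tau z)) = z] &
      forall x, A' x -> forall chi : VT -> Prop,
        (forall e, fiber ET x e -> rho (s e) = rho (r e) ->
           (chi (s e) <-> chi (r e))) ->
        forall v, fiber VT x v -> (chi v <-> chi (act VT x (tau (rho v))))].
Proof.
have [h [mh Hh]] := rset_enumeration sX (@vertices_countable _ _ _ _ _ T).
have [k [mk Hk]] := rset_enumeration sX (@edges_countable _ _ _ _ _ T).
pose DV n : set X := A' `&` [set x | carrier VT (h n x)].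
have mDV n : measurable (DV n).
  by apply: mbor_comp (carrier_measurable VT) => //; exact: measurable_funTS.
pose DV' n : set X := DV n `&` [set x | proj VT (h n x) = x].
have mprojh n : measurable_fun (DV n) (proj VT \o h n).
  apply: (measurable_comp (carrier_measurable VT)).
  - by move=> _ [x [_ Cx] <-].
  - exact: proj_measurable.
  - exact: measurable_funTS.
have mDV' n : measurable (DV' n).
  apply: (@mbor_eq _ _ _ _ (DV n) (proj VT \o h n) id) => //.
  exact: standard_coded sX.
have DV'over n x : DV' n x -> over (h n x).
  by move=> [[Ax Cx] px]; split=> //; rewrite /preimage /= px.
have mpih n : measurable_fun (DV' n) (pi \o h n).
  apply: (measurable_comp m_over) => //; last exact: measurable_funTS.
  by move=> _ [x Dx <-]; apply: DV'over Dx.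
pose Qn n : set X := DV' n `&` [set x | pi (h n x) = x].
have mQn n : measurable (Qn n).
  apply: (@mbor_eq _ _ _ _ (DV' n) (pi \o h n) id) => //.
  exact: standard_coded sX.
have [tau mtau Htau] := first_choice mQn (fun n => measurable_funTS (mh n)).
pose Q := \bigcup_n Qn n.
have mQ : measurable Q by apply: bigcupT_measurable.
have QA : Q `<=` A' by move=> x [n _ [[[]]]].
have tauP x : Q x -> [/\ fiber VT x (tau x), over (tau x) & pi (tau x) = x].
  move=> [n _ Qx]; have [|m [Qm -> _]] := Htau x; first by exists n.
  have [Dm pm] := Qm; split=> //; last exact: DV'over Dm.
  by have [[_ Cm] ?] := Dm.
have Qpi v : over v -> Q (pi v).
  move=> Ov; have Ob := base_over Ov.
  have [n hn] := Hh _ Ob.1; rewrite base_proj // in hn.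
  exists n => //; split; last by rewrite /mkset -hn pi_base.
  by split; [split; [exact: Api|]|]; rewrite /mkset -hn ?base_proj //; case: Ob.
(* Centres: the vertices v whose representative is the one kept over pi v. *)
pose Cen : set VT := over `&` [set v | base v = tau (pi v)].
have mCen : measurable Cen.
  apply: (@mbor_eq _ _ _ _ over base (tau \o pi)) => //.
    exact: standard_coded (rs_standard VT).
  apply: (measurable_comp mQ) => //.
  by move=> _ [v Ov <-]; exact: Qpi.
have Cen_tau x z : A' x -> R (x, z) -> Q z -> Cen (act VT x (tau z)) /\
    pi (act VT x (tau z)) = z.
  move=> Ax Rxz Qz; have [[Ct pt] Ot pit] := tauP _ Qz.
  have Rx : R (x, proj VT (tau z)) by rewrite pt.
  have piz : pi (act VT x (tau z)) = z by rewrite pi_act.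
  split=> //; split; first exact: over_act.
  rewrite /mkset base_act // piz /base pit -{1}pt act_id //.
(* The number m codes an edge m./2 over pi v and a direction odd m; st and nx are
the start and the end of this step. *)
pose ed m v : ET := k m./2 (pi v).
pose DE m : set VT := over `&` [set v | carrier ET (ed m v)].
have med m (D : set VT) : D `<=` over -> measurable D -> measurable_fun D (ed m).
  move=> DO mD; apply: measurableT_comp => //.
  by apply: measurable_funS mpi.
have mDE m : measurable (DE m).
  apply: mbor_comp (carrier_measurable ET) => //; exact: med.
pose st m v := step_start s r (ed m v, odd m).
pose nx m v := step_end s r (ed m v, odd m).
have DEO m : DE m `<=` over by move=> v [].
have msr m : measurable_fun (DE m) (s \o ed m) /\ measurable_fun (DE m) (r \o ed m).
  split; apply: (measurable_comp (carrier_measurable ET));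
    try (by move=> _ [v [_ Cv] <-]); try exact: med.
    exact: src_measurable.
  exact: rng_measurable.
have mst m : measurable_fun (DE m) (st m).
  by rewrite /st /step_start /=; case: (odd m); [case: (msr m)|case: (msr m)].
have mnx m : measurable_fun (DE m) (nx m).
  by rewrite /nx /step_end /=; case: (odd m); [case: (msr m)|case: (msr m)].
pose Dom m : set VT := DE m `&` [set v | st m v = base v /\ proj ET (ed m v) = pi v].
have mDom m : measurable (Dom m).
  apply: (mbor_and (mDE m)).
    apply: (@mbor_eq _ _ _ _ (DE m)) => //.
      exact: standard_coded (rs_standard VT).
    exact: measurable_funS m_over (@DEO m) m_base.
  apply: (@mbor_eq _ _ _ _ (DE m) (proj ET \o ed m) pi) => //.
  - exact: standard_coded sX.
  - apply: (measurable_comp (carrier_measurable ET));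
      [by move=> _ [v [_ Cv] <-]|exact: proj_measurable|exact: med].
  - exact: measurable_funS m_over (@DEO m) mpi.
have DomP m v : Dom m v -> [/\ over v, fiber ET (pi v) (ed m v), over (nx m v) &
    proj VT (nx m v) = pi v].
  move=> [[Ov Ce] [_ pe]]; have fe : fiber ET (pi v) (ed m v) by [].
  have [Os Or ps pr] := edge_over (Api Ov) fe.
  by split; rewrite // /nx /step_end; case: ifP.
have Dom_act m v x : over v -> R (x, proj VT v) ->
    (Dom m (act VT x v) <-> Dom m v) /\ nx m (act VT x v) = nx m v.
  move=> Ov Rx; have Ox := over_act Ov Rx.
  rewrite /Dom /DE /st /nx /ed /setI /mkset pi_act // base_act //.
  by split=> //; split=> -[[_ ?] ?].
have mDomN m (L : set VT) : measurable L -> measurable (Dom m `&` nx m @^-1` L).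
  move=> mL; suff mnx' : measurable_fun (Dom m) (nx m) by exact: mnx'.
  by apply: measurable_funS (mnx m) => // v [].
have connected x v w : A' x -> fiber VT x v -> fiber VT x w ->
    same_component s r (fiber ET x) v w.
  by move=> Ax fv fw; have [_ [_ +] _] := fiber_tree T (A'A Ax); apply.
(* rho is meaningful on L only. *)
pose stage (p : set VT * (VT -> X)) := let: (L, rho) := p in
  [/\ [/\ measurable L, L `<=` over & measurable_fun L rho],
      forall v, L v -> R (rho v, proj VT v) /\ Q (rho v),
      forall x v, L v -> R (x, proj VT v) ->
        L (act VT x v) /\ rho (act VT x v) = rho v,
      forall v, Cen v -> L v /\ rho v = pi v &
      forall x, A' x -> forall chi : VT -> Prop,
        (forall e, fiber ET x e -> L (s e) -> L (r e) ->
           rho (s e) = rho (r e) -> (chi (s e) <-> chi (r e))) ->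
        forall v, fiber VT x v -> L v ->
          (chi v <-> chi (act VT x (tau (rho v))))].
pose next (p q : set VT * (VT -> X)) :=
  [/\ p.1 `<=` q.1, forall v, p.1 v -> q.2 v = p.2 v &
      forall x e, A' x -> fiber ET x e ->
        (p.1 (s e) -> q.1 (r e)) /\ (p.1 (r e) -> q.1 (s e))].
have stage0 : stage (Cen, pi).
  split.
  - by split=> [//|v []//|]; apply: measurable_funS mpi => // v [].
  - by move=> v [Ov _]; split; [exact: piR|exact: Qpi].
  - move=> x v [Ov bv] Rx; rewrite pi_act //; split=> //; split; first exact: over_act.
    by rewrite /mkset base_act // pi_act.
  - by [].
  - move=> x Ax chi _ v [Cv pv] [Ov <-]; rewrite act_base ?pv //.
    by rewrite -pv act_id.
have stageS p : stage p -> exists q, stage q /\ next p q.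
  case: p => L rho [[mL LO mrho] rhoR rho_act rhoC rhoG].
  pose D j := if j is m.+1 then Dom m `&` nx m @^-1` L else L.
  pose f j := if j is m.+1 then rho \o nx m else rho.
  have mD j : measurable (D j) by case: j => // m; exact: mDomN.
  have mf j : measurable_fun (D j) (f j).
    case: j => // m; apply: (measurable_comp mL) => //.
      by move=> _ [v [_ Lv] <-].
    apply: measurable_funS (mnx m) => //; first by move=> v [[]].
  (* Index 0 stands for the vertices already in L, so that rho' extends rho. *)
  have [rho' mrho' Hrho'] := first_choice mD mf.
  pose L' := \bigcup_j D j.
  have DO j : D j `<=` over.
    by case: j => [|m] v; [exact: LO|case=> /DomP[]].
  have D_act j v x : over v -> R (x, proj VT v) ->
      (D j (act VT x v) <-> D j v) /\ (D j v -> f j (act VT x v) = f j v).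
    move=> Ov Rx; case: j => [|m] /=.
      split; last by move=> Lv; case: (rho_act x v).
      split=> Lv; last by case: (rho_act x v).
      have := (rho_act (proj VT v) (act VT x v) Lv).
      have [Cv _] := Ov; rewrite act_proj // => /(_ (Rsym Rx))[+ _].
      by rewrite act_comp ?act_id //; exact: Rsym.
    have [Da na] := Dom_act m v x Ov Rx; rewrite /preimage /= na.
    by split=> //; split=> -[/Da].
  have rho'L v : L v -> rho' v = rho v.
    move=> Lv; have [|[|j] [_ ->//]] := Hrho' v; first by exists 0.
    by move=> /(_ 0 isT Lv).
  have LL' : L `<=` L' by move=> v Lv; exists 0.
  have rho'P v : L' v -> L v \/ exists m, [/\ Dom m v, L (nx m v) & rho' v = rho (nx m v)].
    move=> [j _ Dj]; have [|[|m] [Dm rv _]] := Hrho' v; first by exists j.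
      by left.
    by right; exists m; case: Dm.
  exists (L', rho'); split; [split|split].
  - split=> //; first exact: bigcupT_measurable.
    by move=> v [j _ /DO].
  - move=> v /rho'P[Lv|[m [Dm Lm ->]]].
      by rewrite rho'L //; apply: rhoR.
    have [Ov fe On pn] := DomP _ _ Dm; have [Rn Qn'] := rhoR _ Lm.
    by split=> //; apply: Rtrans (piR Ov); rewrite -pn.
  - move=> x v L'v Rx; have Ov : over v by case: L'v => j _ /DO.
    have L'x : L' (act VT x v).
      by case: L'v => j _ Dj; exists j => //; apply/(D_act j v x Ov Rx).1.
    split=> //.
    have [|j [Dj -> jmin]] := Hrho' v; first by case: L'v => j _ Dj; exists j.
    have [|i [Di -> imin]] := Hrho' (act VT x v); first by case: L'x => i _ Di; exists i.
    have Di' := (D_act i v x Ov Rx).1.1 Di; have Dj' := (D_act j v x Ov Rx).1.2 Dj.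
    have -> : i = j.
      case: (ltngtP i j) => // ij; first by case: (jmin i ij).
      by case: (imin j ij).
    exact: (D_act j v x Ov Rx).2.
  - by move=> v /rhoC[Lv <-]; split; [exact: LL'|exact: rho'L].
  - move=> x Ax chi Hchi v fv /rho'P.
    have HL : forall e, fiber ET x e -> L (s e) -> L (r e) ->
           rho (s e) = rho (r e) -> (chi (s e) <-> chi (r e)).
      move=> e fe Ls Lr E; apply: Hchi => //; [exact: LL'|exact: LL'|].
      by rewrite !rho'L.
    case=> [Lv|[m [Dm Lm rv]]]; first by rewrite rho'L //; exact: rhoG.
    have [Ov fe On pn] := DomP _ _ Dm.
    have Rxp : R (x, pi v) by apply: Rsym; have := piR Ov; case: fv => _ ->.
    have Rxe : R (x, proj ET (ed m v)) by case: fe => _ ->.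
    have [fx sx rx] := edge_act fe.1 Rxe.
    have Rxn : R (x, proj VT (nx m v)) by rewrite pn.
    have [Ln rn] := rho_act x _ Lm Rxn.
    have fn : fiber VT x (act VT x (nx m v)).
      by split; [apply: act_carrier => //; case: On|apply: act_proj => //; case: On].
    have := rhoG x Ax chi HL _ fn Ln; rewrite rn -rv; apply: iff_trans.
    have vx : act VT x (st m v) = v.
      have [_ [-> _]] := Dm; rewrite act_base //; last by case: fv => _ ->.
      by case: fv => Cv <-; rewrite act_id.
    have L'v : L' v by exists m.+1.
    have L'n : L' (act VT x (nx m v)) by exact: LL'.
    have rvn : rho' v = rho' (act VT x (nx m v)) by rewrite (rho'L _ Ln) rn.
    have := Hchi _ fx; rewrite sx rx; move: vx L'n rvn; rewrite /st /nx /step_start /step_end /=.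
    case: (odd m) => -> L'n rvn Hc.
      exact: Hc.
    by apply: iff_sym; apply: Hc.
  - exact: LL'.
  - exact: rho'L.
  - have nbr x e b : A' x -> fiber ET x e -> L (step_end s r (e, b)) ->
        L' (step_start s r (e, b)).
      move=> Ax fe Le; have [Os Or ps pr] := edge_over Ax fe.
      set u := step_start _ _ _; set w := step_end _ _ _ in Le.
      have Ou : over u by rewrite /u /step_start; case: ifP.
      have pu : proj VT u = x by rewrite /u /step_start; case: ifP.
      have Rpx : R (pi u, x) by rewrite -pu; exact: piR.
      have Rpe : R (pi u, proj ET e) by case: fe => _ ->.
      have [fp sp rp] := edge_act fe.1 Rpe.
      have [n hn] := Hk _ fp.1; rewrite fp.2 in hn.
      pose m := b + n.*2.
      have m2 : m./2 = n by rewrite /m half_bit_double.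
      have mb : odd m = b by rewrite /m oddD odd_double addbF; case: (b).
      have edm : ed m u = act ET (pi u) e by rewrite /ed m2 -hn.
      exists m.+1 => //=; split.
        split; first by split=> //; rewrite /mkset edm; case: fp.
        split; last by rewrite edm; case: fp.
        by move: sp rp; rewrite /st edm mb /base /u /step_start /=; case: (b) => /= ? ?.
      rewrite /preimage /=; have -> : nx m u = act VT (pi u) w.
        by rewrite /nx edm mb /w /step_end /=; move: sp rp; case: (b).
      have pw : proj VT w = x by rewrite /w /step_end; case: ifP.
      by have [] := rho_act (pi u) w Le; rewrite ?pw.
    move=> x e Ax fe; split=> Le.
      exact: (nbr x e false).
    exact: (nbr x e true).
pose state := {p | stage p}.
have [q [q0 Hq]] : exists q : nat -> state,
    q 0 = exist _ _ stage0 /\ forall n, next (projT1 (q n)) (projT1 (q n.+1)).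
  have step (p : state) : {q : state | next (projT1 p) (projT1 q)}.
    case: p => p sp; apply: cid; have [q [sq pq]] := stageS p sp.
    by exists (exist _ _ sq).
  have [q Hq] := dependent_choice step (exist _ _ stage0).
  by exists q.
pose L n := (projT1 (q n)).1; pose rh n := (projT1 (q n)).2.
have Hst n : stage (L n, rh n).
  by rewrite /L /rh; case: (q n) => -[].
have Lmono n m : n <= m -> forall v, L n v -> L m v /\ rh m v = rh n v.
  move=> /subnK <-; elim: (m - n) => // i IH v Lv; have [Lv' E] := IH v Lv.
  have [LL rr _] := Hq (i + n); split; first exact: LL.
  by rewrite -E; apply: rr.
have mL n : measurable (L n) by have [[]] := Hst n.
have mrh n : measurable_fun (L n) (rh n) by have [[]] := Hst n.
have [rho mrho Hrho] := first_choice mL mrh.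
have rhoE n v : L n v -> rho v = rh n v.
  move=> Lv; have [|m [Lm -> _]] := Hrho v; first by exists n.
  have [_ <-] := Lmono _ _ (leq_maxl n m) _ Lv.
  by have [_ <-] := Lmono _ _ (leq_maxr n m) _ Lm.
have L0 v : Cen v -> L 0 v by rewrite /L q0.
have exh v : over v -> exists n, L n v.
  move=> Ov; pose x := proj VT v.
  have Ax : A' x by case: Ov.
  have Qp := Qpi v Ov; have [ft Ot pt] := tauP _ Qp.
  have Rx : R (x, pi v) by apply: Rsym; exact: piR.
  have [Cc _] := Cen_tau x _ Ax Rx Qp.
  have fc : fiber VT x (act VT x (tau (pi v))).
    by split; [case: Cc => -[]|apply: act_proj; case: ft => // _ ->].
  apply: (@conn_invariant _ _ s r (fiber ET x) (fun w => exists n, L n w) _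
    (act VT x (tau (pi v))) v) => //.
  - move=> e fe; split=> -[n Ln]; exists n.+1.
      by have [_ _ /(_ x e Ax fe)[+ _]] := Hq n; apply.
    by have [_ _ /(_ x e Ax fe)[_ +]] := Hq n; apply.
  - by apply: connected => //; case: Ov.
  - by exists 0; exact: L0.
have overE : \bigcup_n L n = over.
  apply/seteqP; split=> [v [n _]|v /exh[n Ln]]; last by exists n.
  by have [[_ LO _] _ _ _ _] := Hst n; apply: LO.
exists Q, tau, rho; split; [split=> // x Qx|split|].
- by case: (tauP x Qx).
- by rewrite -overE.
- by move=> v /exh[n Ln]; rewrite (rhoE _ _ Ln); have [_ + _ _ _] := Hst n; apply.
- move=> x v /exh[n Ln] Rx; have [_ _ /(_ x v Ln Rx)[Lx E] _ _] := Hst n.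
  by rewrite (rhoE _ _ Ln) (rhoE _ _ Lx).
- move=> x z Ax Rxz Qz; have [Cc pz] := Cen_tau x z Ax Rxz Qz.
  by have [_ _ _ /(_ _ Cc)[LC E] _] := Hst 0; rewrite (rhoE 0 _ LC) E.
- move=> x Ax chi Hchi v fv.
  have Ov : over v by split; [case: fv|case: fv => _; rewrite /preimage /= => ->].
  have [n Ln] := exh v Ov; have [_ _ _ _ G] := Hst n.
  rewrite (rhoE _ _ Ln); apply: G => // e fe Ls Lr E.
  by apply: Hchi => //; rewrite (rhoE _ _ Ls) (rhoE _ _ Lr).
Qed.

End Contraction.

(** * From R-trees to treeings *)

Section TreeingOfTree.
Context (F : realType) d (X : measurableType d) (R : set (X * X)) (A A' : set X).
Context (T : rtree F R A).
Hypotheses (sX : standard_borel F X) (bR : borel_equiv_rel R).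
Hypotheses (mA' : measurable A') (iA' : invariant R A') (A'A : A' `<=` A).
Hypothesis cR : forall x, A' x -> countable (eclass R x).

Local Notation VT := (vertices T).
Local Notation ET := (edges T).
Local Notation s := (@src _ _ _ _ _ T).
Local Notation r := (@rng _ _ _ _ _ T).

Context (pi : VT -> X).
Hypotheses (mpi : measurable_fun (@over _ _ _ _ _ A' T) pi).
Hypotheses (piR : forall v, over A' v -> R (pi v, proj VT v)).
Hypotheses (pi_act : forall x v, over A' v -> R (x, proj VT v) ->
  pi (act VT x v) = pi v).

Let mR : measurable R. Proof. by case: bR. Qed.
Let Rrefl x : R (x, x). Proof. by case: bR => _ []. Qed.
Let Rsym x y : R (x, y) -> R (y, x). Proof. by case: bR => _ [_ + _]; apply. Qed.
Let Rtrans x y z : R (x, y) -> R (y, z) -> R (x, z).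
Proof. by case: bR => _ [_ _]; apply. Qed.

(** The edges of T joining distinct blocks of the contraction form a tree on the
set Q of centres, because blocks are connected; the points outside Q are joined
as leaves to a point of Q in their class. Each edge of this graph inherits a cut
from the edge of T that it comes from. *)
Lemma treeing_of_rtree : exists K, treeing_on A' R K.
Proof.
have [Q [tau [rho [[mQ QA tauP Qpi] [mrho rhoP rho_act rho_tau] rhoG]]]] :=
  contraction sX bR mA' iA' A'A mpi piR pi_act.
have [h [mh Hh]] := rset_enumeration sX (@vertices_countable _ _ _ _ _ T).
have [k [mk Hk]] := rset_enumeration sX (@edges_countable _ _ _ _ _ T).
have m_over : measurable (@over _ _ _ _ _ A' T).
  exact: (proj_measurable (carrier_measurable VT) mA').
have cX := standard_coded sX.
(* A Borel choice of a point of Q in every class. *)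
have [t mt tP] : exists2 t : X -> X, measurable_fun A' t &
    forall x, A' x -> R (t x, x) /\ Q (t x).
  pose D n : set X := (A' `&` [set x | carrier VT (h n x)]) `&`
    [set x | (proj VT \o h n) x = id x].
  have mD0 n : measurable (A' `&` [set x | carrier VT (h n x)]).
    by apply: mbor_comp (carrier_measurable VT) => //; exact: measurable_funTS.
  have mD n : measurable (D n).
    apply: (@mbor_eq _ _ _ _ _ (proj VT \o h n) id) => //.
    apply: (measurable_comp (carrier_measurable VT)).
    - by move=> _ [x [_ Cx] <-].
    - exact: proj_measurable.
    - exact: measurable_funTS.
  have Dover n x : D n x -> over A' (h n x).
    by move=> [[Ax Cx] /= px]; split=> //; rewrite /preimage /= px.
  have [|t mt Ht] := first_choice mD (f := fun n => pi \o h n).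
    move=> n; apply: (measurable_comp m_over) => //; last exact: measurable_funTS.
    by move=> _ [x Dx <-]; apply: Dover Dx.
  have DA : \bigcup_n D n = A'.
    apply/seteqP; split=> [x [n _ [[]]]//|x Ax].
    have [_ [[v [Cv pv]] _] _] := fiber_tree T (A'A Ax).
    have [n hn] := Hh v Cv; rewrite pv in hn.
    by exists n => //; split; [split=> //|]; rewrite /mkset /= -hn.
  exists t; first by rewrite -DA.
  move=> x Ax; have [|n [Dx -> _]] := Ht x.
    by move: Ax; rewrite -DA => -[n _ Dx]; exists n.
  have Ov := Dover _ _ Dx; split; last exact: Qpi.
  by have := piR Ov; case: Dx => _ /= ->.
(* The edge a <- b is read off over its range a, as T has the same edges over
all the points of a class. *)
pose treeK (ab : X * X) := exists j, [/\ fiber ET ab.1 (k j ab.1),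
  rho (r (k j ab.1)) = ab.1, rho (s (k j ab.1)) = ab.2 & ab.1 <> ab.2].
pose K : set (X * X) := [set ab | A' ab.1 /\
  (treeK ab \/ (~ Q ab.1 /\ ab.2 = t ab.1))].
have mK : measurable K.
  have mD : measurable (A' `*` setT : set (X * X)) by exact: measurableX.
  have m1 : measurable_fun (A' `*` setT : set (X * X)) fst.
    exact: measurable_funTS measurable_fst.
  have m2 : measurable_fun (A' `*` setT : set (X * X)) snd.
    exact: measurable_funTS measurable_snd.
  have m1t : measurable_fun (A' `*` setT : set (X * X)) (t \o fst).
    by apply: (measurable_comp mA') => // _ [ab [? _] <-].
  suff -> : K = (A' `*` setT) `&`
      [set ab : X * X | treeK ab \/ (~ Q ab.1 /\ snd ab = (t \o fst) ab)].
    apply: (mbor_or mD); last first.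
      apply: (mbor_and mD); last exact: mbor_eq.
      by apply: (mbor_not mD); exact: (mbor_comp mD m1 mQ).
    apply: (mbor_ex mD) => j.
    pose D1 : set (X * X) := (A' `*` setT) `&` [set ab | carrier ET ((k j \o fst) ab)].
    have mkj : measurable_fun (A' `*` setT) (k j \o fst : X * X -> ET).
      exact: measurableT_comp.
    have mD1 : measurable D1 by exact: (mbor_comp mD mkj (carrier_measurable ET)).
    have mE d' (U : measurableType d') (f : ET -> U) :
        measurable_fun (carrier ET) f -> measurable_fun D1 (f \o (k j \o fst)).
      move=> mf; apply: (measurable_comp (carrier_measurable ET)) => //.
        by move=> _ [ab [_ Cab] <-].
      by apply: measurable_funS mkj => // ab [].
    pose D2 : set (X * X) := D1 `&` [set ab | (proj ET \o (k j \o fst)) ab = ab.1].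
    have D1A : D1 `<=` A' `*` setT by move=> ab [].
    have mD2 : measurable D2.
      apply: (@mbor_eq _ _ _ _ D1) => //; first exact: mE (proj_measurable (r := ET)).
      exact: measurable_funS m1.
    have D2over ab : D2 ab -> over A' (s (k j ab.1)) /\ over A' (r (k j ab.1)).
      move=> [[[Aa _] Ck] /= pk].
      by have [] := edge_over (T := T) Aa (conj Ck pk).
    have mrs : measurable_fun D2 (rho \o (s \o (k j \o fst))).
      apply: (measurable_comp m_over) => //.
        by move=> _ [ab /D2over[? _] <-].
      by apply: measurable_funS (mE _ _ _ (@src_measurable _ _ _ _ _ T)) => // ab [].
    have mrr : measurable_fun D2 (rho \o (r \o (k j \o fst))).
      apply: (measurable_comp m_over) => //.
        by move=> _ [ab /D2over[_ ?] <-].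
      by apply: measurable_funS (mE _ _ _ (@rng_measurable _ _ _ _ _ T)) => // ab [].
    have D2A : D2 `<=` A' `*` setT by move=> ab [[]].
    have m1' := measurable_funS mD D2A m1; have m2' := measurable_funS mD D2A m2.
    rewrite /mbor /bor.
    suff -> : (A' `*` setT) `&` [set ab | [/\ fiber ET ab.1 (k j ab.1),
        rho (r (k j ab.1)) = ab.1, rho (s (k j ab.1)) = ab.2 & ab.1 <> ab.2]] =
      D2 `&` [set ab | (rho \o (r \o (k j \o fst))) ab = fst ab /\
        ((rho \o (s \o (k j \o fst))) ab = snd ab /\ ~ (fst ab = snd ab))].
      apply: (mbor_and mD2); first exact: mbor_eq.
      apply: (mbor_and mD2); first exact: mbor_eq.
      by apply: (mbor_not mD2); exact: mbor_eq.
    by apply/seteqP; split=> ab; [move=> [? [[? ?] ? ? ?]]|move=> [[[? ?] ?] [? [? ?]]]].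
  by apply/seteqP; split=> [ab [? ?]|ab [[? _] ?]].
have KR ab : K ab -> R ab /\ A' ab.2.
  case: ab => a b /= [Aa Kab].
  have Rab : R (a, b).
    case: Kab => [[j [fe _ /= <- _]]|[_ /= ->]]; last by apply: Rsym; case: (tP _ Aa).
    have [Os _ ps _] := edge_over Aa fe.
    by have [] := rhoP _ Os; rewrite ps => /Rsym.
  by split=> //; apply: iA' (Rsym Rab) Aa.
have KQ a b : treeK (a, b) -> A' a -> Q a /\ Q b.
  move=> [j [fe /= ra rb _]] Aa.
  have [Os Or _ _] := edge_over Aa fe.
  by rewrite -{1}ra -rb; split; [case: (rhoP _ Or)|case: (rhoP _ Os)].
have edgeK x e : A' x -> fiber ET x e -> rho (s e) <> rho (r e) ->
    K (rho (r e), rho (s e)).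
  move=> Ax fe sr; set a := rho (r e).
  have [Os Or ps pr] := edge_over Ax fe.
  have [Rra Qa] := rhoP _ Or; rewrite pr in Rra.
  have Aa : A' a by apply: iA' Rra Ax.
  have Rae : R (a, proj ET e) by case: fe => _ ->.
  have [fa sa ra] := edge_act fe.1 Rae.
  have [j kj] := Hk _ fa.1; rewrite fa.2 in kj.
  split=> //; left; exists j; rewrite /= -kj sa ra; split=> //.
  - by rewrite rho_act ?pr.
  - by rewrite rho_act ?ps.
  - exact: nesym.
have connV x v w : A' x -> fiber VT x v -> fiber VT x w ->
    same_component snd fst K (rho v) (rho w).
  move=> Ax fv fw; have [_ [_ /(_ v w fv fw) vw] _] := fiber_tree T (A'A Ax).
  apply: (@conn_invariant _ _ s r (fiber ET x)
    (fun w => same_component snd fst K (rho v) (rho w)) _ v w) => //; last first.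
    exact: conn_refl.
  move=> e fe; have [->//|sr] := pselect (rho (s e) = rho (r e)).
  have Ke := edgeK x e Ax fe sr.
  by split=> H; apply: conn_trans H _;
    [exact: (conn_edge snd fst Ke)|exact: (conn_edgeV snd fst Ke)].
have connP x v z : A' x -> R (z, x) -> fiber VT x v ->
    same_component snd fst K z (rho v).
  move=> Ax Rzx fv; have Az : A' z by apply: iA' Rzx Ax.
  have connQ y : R (y, x) -> Q y -> same_component snd fst K y (rho v).
    move=> Ryx Qy; have [Ct pt] := tauP _ Qy.
    have Rx : R (x, proj VT (tau y)) by rewrite pt; exact: Rsym.
    rewrite -{1}(rho_tau x y Ax (Rsym Ryx) Qy); apply: (connV x) => //.
    by split; [exact: act_carrier|exact: act_proj].
  have [Qz|nQz] := pselect (Q z); first exact: connQ.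
  have [Rtz Qt] := tP _ Az.
  have Kz : K (z, t z) by split=> //; right.
  apply: (@conn_trans _ _ _ _ _ _ (t z)); first exact: (conn_edgeV snd fst Kz).
  by apply: connQ => //; apply: Rtrans Rtz Rzx.
have Vne x : A' x -> exists v, fiber VT x v.
  by move=> Ax; have [_ [[v ?] _] _] := fiber_tree T (A'A Ax); exists v.
have KRc x y : same_component snd fst K x y -> R (x, y).
  move=> xy; apply: (@conn_invariant _ _ snd fst K (fun z => R (x, z)) _ x y) => //.
  by move=> [a b] /KR[/= Rab _]; split=> H; [apply: Rtrans H (Rsym Rab)|
    apply: Rtrans H Rab].
have Kconn x y : A' x -> R (y, x) -> same_component snd fst K x y.
  move=> Ax Ryx; have [v fv] := Vne x Ax.
  apply: conn_trans (connP x v x Ax (Rrefl x) fv) _.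
  by apply: conn_sym; apply: (connP x).
exists K; split=> //.
- move=> ab Kab; have [Rab Ab] := KR _ Kab.
  by split=> //; split=> //; case: Kab.
- move=> x y Ax Ay; split; first exact: KRc.
  by move=> Rxy; apply: Kconn => //; exact: Rsym.
move=> x Ax; set c := eclass R x; set E := K `&` _.
split.
- split; first exact: cR.
    apply: (@sub_countable _ _ _ (c `*` c)); first by apply: subset_card_le => ? [].
    by apply: countableX; exact: cR.
  by move=> ab [_ [? ?]].
- split; first by exists x; exact: Rrefl.
  move=> y z cy cz; have Ay : A' y by apply: iA' cy Ax.
  have Kyz : same_component snd fst K y z.
    by apply: Kconn => //; apply: Rtrans cz (Rsym cy).
  suff [] : c z /\ same_component snd fst E y z by [].
  apply: (@conn_invariant _ _ snd fst K
    (fun w => c w /\ same_component snd fst E y w) _ y z) => //; last first.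
    by split=> //; exact: conn_refl.
  move=> [a b] Kab /=; have [Rab _] := KR _ Kab.
  have cab : c a <-> c b.
    by split=> H; [exact: Rtrans (Rsym Rab) H|exact: Rtrans Rab H].
  split=> -[/= c1 H]; have Eab : E (a, b) by split=> //; split=> //=; apply/cab.
    by split; [exact/cab|exact: conn_trans H (conn_edge snd fst Eab)].
  by split; [exact/cab|exact: conn_trans H (conn_edgeV snd fst Eab)].
apply: cut_acyclic => -[a b] [[/= Aa Kab] [/= ca cb]].
case: Kab => [tab|[nQa /= bt]]; last first.
  (* A leaf is cut off by its only edge. *)
  have [_ Qt] := tP _ Aa.
  exists (fun z => z <> a); split=> /=.
  - by rewrite bt => ta; apply: nQa; rewrite -ta.
  - exact.
  - move=> [a' b'] [[/= Aa' Kab'] _] ne.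
    have [Qb' a'a] : Q b' /\ a' <> a.
      case: Kab' => [/KQ/(_ Aa')[Qa' Qb']|[_ /= bt']].
        by split=> // a'a; apply: nQa; rewrite -a'a.
      split; first by rewrite bt'; case: (tP _ Aa').
      by move=> a'a; apply: ne; rewrite bt bt' a'a.
    by split=> // _ b'a; apply: nQa; rewrite -b'a.
(* The edge e of T behind an edge of K cuts the fibre of T over x in two, and
each block lies on one side because blocks are connected without e. *)
have lift a' b' : R (a', x) -> A' a' -> treeK (a', b') ->
    exists e, [/\ fiber ET x e, rho (s e) = b', rho (r e) = a' & a' <> b'].
  move=> Rax Aa' [j [fe /= ra rb ab]].
  have Rxe : R (x, proj ET (k j a')) by case: fe => _ ->; exact: Rsym.
  have [Os Or ps pr] := edge_over Aa' fe.
  have [fx sx rx] := edge_act fe.1 Rxe.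
  exists (act ET x (k j a')); split=> //.
    by rewrite sx rho_act // ps; exact: Rsym.
  by rewrite rx rho_act // pr; exact: Rsym.
have [e [fe se re ab]] := lift a b ca Aa tab.
have acT : acyclic_graph s r (fiber ET x) by case: (fiber_tree T (A'A Ax)).
pose chi v := same_component s r (fiber ET x `\ e) (s e) v.
have chiE f : fiber ET x f -> f <> e -> (chi (s f) <-> chi (r f)).
  move=> ff fne; have ffe : (fiber ET x `\ e) f by [].
  by split=> H; apply: conn_trans H _;
    [exact: (conn_edge s r ffe)|exact: (conn_edgeV s r ffe)].
have chiG v : fiber VT x v -> (chi v <-> chi (act VT x (tau (rho v)))).
  apply: rhoG => // f ff rf; apply: chiE => // fE.
  by apply: ab; rewrite -se -re -fE.
pose col z := (Q z /\ chi (act VT x (tau z))) \/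
  (~ Q z /\ chi (act VT x (tau (t z)))).
have colV v : fiber VT x v -> (col (rho v) <-> chi v).
  move=> fv; have Ov : over A' v.
    by split; [case: fv|case: fv => _; rewrite /preimage /= => ->].
  have [_ Qr] := rhoP _ Ov; rewrite chiG // /col.
  by split=> [[[_]//|[//]]|?]; left.
have ends f : fiber ET x f -> fiber VT x (s f) /\ fiber VT x (r f).
  by move=> [Cf <-]; exact: edge_ends.
exists col; split=> /=.
- rewrite -se; apply/colV; first by case: (ends _ fe).
  exact: conn_refl.
- rewrite -re => /colV; case: (ends _ fe) => _ fr /(_ fr).
  exact: acyclic_bridge acT fe.
move=> [a' b'] [[/= Aa' Kab'] [/= ca' cb']] ne.
case: Kab' => [tab'|[nQa' /= bt']].
  have [f [ff sf rf ab']] := lift a' b' ca' Aa' tab'.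
  have [fs fr] := ends _ ff.
  rewrite -sf -rf !colV //; apply: chiE => // fE.
  by apply: ne; rewrite -rf -sf fE se re.
have [_ Qt] := tP _ Aa'; rewrite /col -bt'; rewrite -bt' in Qt.
by split=> [[[_ ?]|[]//]|[[]//|[_ ?]]]; [right|left].
Qed.

End TreeingOfTree.

(** * The almost equality class of a finite index treeing *)

Definition lexN (x y : nat -> nat) : Prop :=
  exists2 n, agree n x y & x n < y n.

Lemma lexN_irr x : ~ lexN x x.
Proof. by move=> [n _]; rewrite ltnn. Qed.

Lemma lexN_trans x y z : lexN x y -> lexN y z -> lexN x z.
Proof.
move=> [n xy xyn] [m yz yzm]; case: (ltngtP n m) => nm.
- exists n; last by rewrite -yz.
  by move=> i ilt; rewrite xy // yz // (ltn_trans ilt nm).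
- exists m; last by rewrite xy.
  by move=> i ilt; rewrite xy ?yz // (ltn_trans ilt nm).
- subst m; exists n; last exact: ltn_trans yzm.
  by move=> i ilt; rewrite xy ?yz.
Qed.

Lemma lexN_total x y : x <> y -> lexN x y \/ lexN y x.
Proof.
move=> xy; have ex : exists i, x i != y i.
  apply: contrapT => /forallNP nE; apply: xy; apply/funext => i.
  by apply/eqP/negPn/negP; exact: nE.
case: (ex_minnP ex) => n xyn nmin.
have agr : agree n x y.
  by move=> i ilt; apply/eqP/negPn/negP => /nmin; rewrite leqNgt ilt.
case: (ltngtP (x n) (y n)) xyn => // xyn _; first by left; exists n.
by right; exists n => // i /agr.
Qed.

Lemma finite_minimal (T : eqType) (lt : T -> T -> Prop) (P : T -> Prop) (l : seq T) :
  (forall x, ~ lt x x) -> (forall x y z, lt x y -> lt y z -> lt x z) ->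
  (exists2 z, z \in l & P z) ->
  exists2 z, z \in l /\ P z & forall z', z' \in l -> P z' -> ~ lt z' z.
Proof.
move=> irr tr; elim: l => [|a l IH] [z]; first by [].
rewrite inE => zin Pz; have [[y yl Py]|nl] := pselect (exists2 y, y \in l & P y).
  have [w [wl Pw] wmin] := IH (ex_intro2 _ _ y yl Py).
  have [[Pa aw]|naw] := pselect (P a /\ lt a w).
    exists a; first by rewrite mem_head.
    move=> z' + Pz'; rewrite inE => /orP[/eqP -> //|z'l z'a].
    by apply: (wmin z' z'l Pz'); apply: tr aw.
  exists w; first by rewrite inE wl orbT.
  move=> z' + Pz'; rewrite inE => /orP[/eqP z'a|z'l]; last exact: wmin.
  by move=> zw; apply: naw; rewrite -z'a.
have za : z = a by case/orP: zin => [/eqP//|zl]; case: nl; exists z.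
exists z; first by rewrite za mem_head -za.
move=> z' + Pz'; rewrite inE => /orP[/eqP ->|z'l]; first by rewrite za.
by case: nl; exists z'.
Qed.

Section AlmostClass.
Context (F : realType) d (X : measurableType d) (R S K : set (X * X)) (A : set X).
Hypotheses (sX : standard_borel F X) (bR : borel_equiv_rel R).
Hypotheses (iA : invariant R A).
Hypotheses (bS : borel_equiv_rel S) (SR : forall x y, A y -> S (x, y) -> R (x, y)).
Hypotheses (mK : measurable K) (KSA : K `<=` S `&` (A `*` A)).
Hypotheses (connK : forall x y, A x -> A y -> (same_component snd fst K x y <-> S (x, y))).
Hypotheses (acK : acyclic_graph snd fst K).
Hypotheses (finS : forall x, A x -> exists l : seq X,
  forall y, R (y, x) -> exists2 z, z \in l & S (y, z)).
Context (g : nat -> X -> X).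
Hypotheses (mg : forall n, measurable_fun setT (g n)).
Hypotheses (gR : forall n x, R (g n x, x)).
Hypotheses (g_onto : forall x y, R (y, x) -> exists n, y = g n x).

Let mR : measurable R. Proof. by case: bR. Qed.
Let Rrefl x : R (x, x). Proof. by case: bR => _ []. Qed.
Let Rsym x y : R (x, y) -> R (y, x). Proof. by case: bR => _ [_ + _]; apply. Qed.
Let Rtrans x y z : R (x, y) -> R (y, z) -> R (x, z).
Proof. by case: bR => _ [_ _]; apply. Qed.
Let mS : measurable S. Proof. by case: bS. Qed.
Let Srefl x : S (x, x). Proof. by case: bS => _ []. Qed.
Let Ssym x y : S (x, y) -> S (y, x). Proof. by case: bS => _ [_ + _]; apply. Qed.
Let Strans x y z : S (x, y) -> S (y, z) -> S (x, z).
Proof. by case: bS => _ [_ _]; apply. Qed.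

Let KR k : K k -> R (k.1, k.2) /\ A k.1.
Proof. by case: k => a b /KSA[/= Sab [/= Aa Ab]]; split=> //; apply: SR. Qed.

Let measurable_edges : measurable [set v : X * (X * X) | K v.2 /\ R (v.1, v.2.1)].
Proof.
rewrite -mborT; apply: (mbor_and measurableT).
  by apply: mbor_comp mK => //; exact: measurable_snd.
apply: (@mbor_comp _ _ _ _ setT (fun v : X * (X * X) => (v.1, v.2.1))) => //.
apply: measurable_fun_pair; first exact: measurable_fst.
by apply: measurableT_comp; [exact: measurable_fst|exact: measurable_snd].
Qed.

(** The forest K of the whole R-class of x, over every point x. The action only
moves the base point, so that each edge (a, b) has the fundamental copy lying
over a. *)
Definition edge_space : rspace F R setT.
Proof.
refine (@RSpace F d X R setT _ (X * (X * X))%type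
  [set v | K v.2 /\ R (v.1, v.2.1)] fst (fun x v => (x, v.2)) _ _ _ _ _ _ _ _ _).
- by apply: standard_borel_prod => //; exact: standard_borel_prod.
- exact: measurable_edges.
- exact: measurable_funTS measurable_fst.
- by [].
- by move=> x [y k] [/= Kk Ryk] Rxy; split=> //=; apply: Rtrans Ryk.
- by [].
- by move=> [].
- by [].
- apply: measurable_funTS; apply: measurable_fun_pair; first exact: measurable_fst.
  by apply: measurableT_comp; [exact: measurable_snd|exact: measurable_snd].
Defined.

Local Notation E := edge_space.

Let fiberE x (e : E) : fiber E x e <-> [/\ K e.2, R (x, e.2.1) & e.1 = x].
Proof.
by split=> [[[Ke Re] <-]//|[Ke Re ex]]; split=> //; split=> //; rewrite ex.
Qed.

Lemma edge_space_countable : countable_rset E.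
Proof.
move=> x; apply: (@sub_countable _ _ _ [set (x, (g n.1 x, g n.2 x)) | n in [set: nat * nat]]).
  apply: subset_card_le => -[y [a b]] /fiberE[/= Kab Rxa ->].
  have [n an] := g_onto (Rsym Rxa).
  have [Rab _] := KR Kab.
  have [m bm] := g_onto (Rtrans (Rsym Rab) (Rsym Rxa)).
  by exists (n, m) => //=; rewrite -an -bm.
by apply: sub_countable (card_image_le _ _) _; exact: countableP.
Qed.

Lemma edge_space_quasi_periodic : quasi_periodic E.
Proof.
exists [set v : E | carrier E v /\ v.1 = v.2.1]; split.
- suff : mbor (carrier E) (fun v : E => fst v = (fst \o snd) v) by [].
  apply: mbor_eq; first exact: standard_coded sX.
  + exact: carrier_measurable.
  + exact: measurable_funTS measurable_fst.
  + apply: measurable_funTS.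
    by apply: measurableT_comp; [exact: measurable_fst|exact: measurable_snd].
- by move=> v [].
- move=> [x k] [/= Kk Rxk]; exists (k.1, k); split.
    split; first by split=> //=; split=> //=; exact: Rrefl.
    by exists k.1; split=> //=; exact: Rsym.
  by move=> [y k'] [[_ /= ->] [z [_ [_ ->]]]].
Qed.

(* The representative over x of the S-class of a is its first point g n x; it
depends on the enumeration over x, and so on x. *)
Definition rep x a n : Prop := S (g n x, a) /\ forall m, m < n -> ~ S (g m x, a).

Let rep_ex x a : R (a, x) -> exists n, rep x a n.
Proof.
move=> /g_onto[m am].
have ex : exists n, `[< S (g n x, a) >] by exists m; apply/asboolP; rewrite -am.
exists (ex_minn ex); case: ex_minnP => n /asboolP Sn nmin; split=> // j jn.
by move=> /asboolP /nmin; rewrite leqNgt jn.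
Qed.

Let rep_cong x a a' n : S (a, a') -> rep x a n -> rep x a' n.
Proof.
move=> Saa [Sn nmin]; split; first exact: Strans Sn Saa.
by move=> m mn H; apply: (nmin m mn); apply: Strans H (Ssym Saa).
Qed.

Let rep_uniq x a n m : rep x a n -> rep x a m -> n = m.
Proof.
move=> [Sn nmin] [Sm mmin]; case: (ltngtP n m) => // nm.
  by case: (mmin n nm).
by case: (nmin m nm).
Qed.

Local Notation towardsK := (towards snd fst K).

(** Over x, orient every tree of the forest K towards its representative. Other
representatives change the orientation of finitely many edges only. *)
Definition orientation x : set E :=
  [set e | fiber E x e /\ exists2 n, rep x e.2.1 n & towardsK (g n x) e.2].

Lemma orientationP x k n : K k -> R (x, k.1) -> rep x k.1 n ->
  (orientation x (x, k) <-> towardsK (g n x) k).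
Proof.
move=> Kk Rxk nk; split=> [[_ [m mk]]|H]; first by rewrite (rep_uniq mk nk).
by split; [apply/fiberE|exists n].
Qed.

Definition almost_class : set (X * set E) :=
  [set xu | xu.2 `<=` fiber E xu.1 /\ almost_equal (orientation xu.1) xu.2].

(* In each of the finitely many S-classes, the representatives over x and over y
are joined by a path, and only the edges of this path are reoriented. *)
Let orientation_move x y : R (x, y) -> exists l : seq (X * X),
  forall k, K k -> R (x, k.1) -> k \notin l ->
    (orientation x (x, k) <-> orientation y (y, k)).
Proof.
move=> Rxy.
have [Ax|nAx] := pselect (A x); last first.
  exists [::] => k Kk Rxk _; case: nAx; apply: iA Rxk _.
  by case: (KR Kk).
have [zs Hzs] := finS Ax.
suff [l Hl] : exists l : seq (X * X), forall k, K k -> R (x, k.1) ->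
    (exists2 z, z \in zs & S (k.1, z)) -> k \notin l ->
    (orientation x (x, k) <-> orientation y (y, k)).
  exists l => k Kk Rxk; apply: Hl => //.
  by apply: Hzs; exact: Rsym.
elim: zs {Hzs} => [|z zs [l Hl]].
  by exists [::] => k _ _ [].
have [[k0 [Kk0 Rxk0 Sk0]]|nk] := pselect (exists k, [/\ K k, R (x, k.1) & S (k.1, z)]);
  last first.
  exists l => k Kk Rxk [z' + Sz'] kl; rewrite inE => /orP[/eqP zz|z'zs].
    by exfalso; apply: nk; exists k; rewrite -zz.
  by apply: Hl => //; exists z'.
have [n nk0] := rep_ex (Rsym Rxk0).
have [m mk0] := rep_ex (Rtrans (Rsym Rxk0) Rxy).
have Ak0 : A k0.1 by case: (KR Kk0).
have Agn : A (g n x) by apply: iA (gR n x) Ax.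
have Agm : A (g m y) by apply: iA (Rtrans (gR m y) (Rsym Rxy)) Ax.
have [l' Hl'] : exists l : seq (X * X), forall e, e \notin l ->
    (towardsK (g n x) e <-> towardsK (g m y) e).
  apply: towards_almost; apply/connK => //.
  exact: Strans nk0.1 (Ssym mk0.1).
exists (l' ++ l) => k Kk Rxk [z' + Sz']; rewrite mem_cat negb_or inE.
move=> /orP[/eqP zz|z'zs] /andP[kl' kl]; last by apply: Hl => //; exists z'.
have Sk : S (k0.1, k.1) by apply: Strans Sk0 _; apply: Ssym; rewrite -zz.
rewrite (orientationP Kk Rxk (rep_cong Sk nk0)) Hl' //.
by rewrite (orientationP Kk (Rtrans (Rsym Rxy) Rxk) (rep_cong Sk mk0)).
Qed.

Let power_actE x y u (k : X * X) : R (x, y) -> u `<=` fiber E y ->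
  (power_act x y u (x, k) <-> u (y, k)).
Proof.
move=> Rxy uE; split=> [[_]//|uk].
have /fiberE[/= Kk Ryk _] := uE _ uk.
by split=> //; apply/fiberE; split=> //=; apply: Rtrans Ryk.
Qed.

Let almost_class_act x y u : R (x, y) -> almost_class (y, u) ->
  almost_class (x, power_act x y u).
Proof.
move=> Rxy [/= uE fu]; split=> /=; first by move=> e [].
have [l Hl] := orientation_move Rxy.
apply: (@sub_finite_set _ _ ((fun k => (x, k) : E) @` [set` l] `|`
  (fun e : E => (x, e.2)) @` (orientation y `+` u))); last first.
  by rewrite finite_setU; split; apply: finite_image.
move=> [x' k] Hk.
have /fiberE[/= Kk Rxk x'x] : fiber E x (x', k) by case: Hk => -[[]].
subst x'; have [kl|kl] := boolP (k \in l); first by left; exists k.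
right; exists (y, k) => //.
have := Hl k Kk Rxk kl; have := power_actE k Rxy uE.
by case: Hk => -[H1 H2]; [left|right]; split; tauto.
Qed.

(* The dummy value of unused codes does no harm: it is a section of E over the
points where it is an edge, and only these are considered. *)
Let section_ m (x : X) : E :=
  if unpickle m is Some (i, j) then (x, (g i x, g j x)) else (x, (x, x)).

Let edge_dom m : set X := [set x | K (section_ m x).2].

Let m_section m : measurable_fun setT (section_ m).
Proof.
rewrite /section_; case: (unpickle m) => [[i j]|].
  apply: measurable_fun_pair; first exact: measurable_id.
  exact: measurable_fun_pair.
by do 2 (apply: measurable_fun_pair; first exact: measurable_id); exact: measurable_id.
Qed.

Let m_section2 m : measurable_fun setT (fun x => (section_ m x).2).
Proof. by apply: (measurableT_comp measurable_snd); exact: m_section. Qed.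

Let m_edge_dom m : measurable (edge_dom m).
Proof. by rewrite -mborT; apply: mbor_comp mK => //; exact: m_section2. Qed.

Let section_fiber m x : edge_dom m x -> fiber E x (section_ m x).
Proof.
rewrite /edge_dom /mkset => Km; apply/fiberE; split=> //.
  rewrite /section_; case: (unpickle m) => [[i j]|] /=; last exact: Rrefl.
  exact: Rsym.
by rewrite /section_; case: (unpickle m) => [[]|].
Qed.

Let section_onto x e : fiber E x e -> exists2 m, edge_dom m x & section_ m x = e.
Proof.
case: e => y [a b] /fiberE[/= Kab Rxa ->].
have [i ai] := g_onto (Rsym Rxa).
have [j bj] := g_onto (Rtrans (Rsym (KR Kab).1) (Rsym Rxa)).
exists (pickle (i, j)).
  by rewrite /edge_dom /mkset /section_ pickleK /= -ai -bj.
by rewrite /section_ pickleK /= -ai -bj.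
Qed.

(* Walks of length N in K, avoiding the edge number m, between the points of the
enumeration numbered n and n'. *)
Let adj m n n' x : Prop :=
  (K (g n x, g n' x) /\ (g n x, g n' x) <> (section_ m x).2) \/
  (K (g n' x, g n x) /\ (g n' x, g n x) <> (section_ m x).2).

Fixpoint linked m N n n' x : Prop :=
  if N is N'.+1 then exists p, adj m n p x /\ linked m N' p n' x
  else g n x = g n' x.

Let m_linked m N n n' : mbor setT (linked m N n n').
Proof.
have cX := standard_coded sX.
elim: N n => [|N IH] n /=; first exact: mbor_eq.
have mpair i j : measurable_fun setT (fun x => (g i x, g j x)).
  exact: measurable_fun_pair.
have ne i j : mbor setT (fun x => (g i x, g j x) <> (section_ m x).2).
  apply: (mbor_not measurableT); apply: mbor_eq => //.
  by apply: (@standard_coded F); exact: standard_borel_prod.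
apply: (mbor_ex measurableT) => p; apply: (mbor_and measurableT) => //.
by apply: (mbor_or measurableT); apply: (mbor_and measurableT) => //;
  apply: mbor_comp mK.
Qed.

Let linkedP m n n' x :
  same_component snd fst (K `\ (section_ m x).2) (g n x) (g n' x) <->
  exists N, linked m N n n' x.
Proof.
split=> [[p]|[N]].
  elim: p n => [|[[a b] c] p IH] n /=; first by exists 0.
  move=> [[Kab ab] sn wp].
  have [Rab _] := KR Kab.
  case: c sn wp; rewrite /step_start /step_end /= => sn wp.
    have [i ai] : exists i, a = g i x.
      by apply: g_onto; apply: Rtrans Rab _; rewrite sn; exact: gR.
    subst a b; have [N HN] := IH i wp.
    by exists N.+1, i; split=> //; right.
  have [i bi] : exists i, b = g i x.
    by apply: g_onto; apply: Rtrans (Rsym Rab) _; rewrite sn; exact: gR.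
  subst a b; have [N HN] := IH i wp.
  by exists N.+1, i; split=> //; left.
elim: N n => [|N IH] n /=; first by move=> ->; exact: conn_refl.
move=> [p [np /IH]]; apply: conn_trans.
case: np => -[Knp ne].
  by have := @conn_edgeV _ _ snd fst (K `\ (section_ m x).2) _ (conj Knp ne).
by have := @conn_edge _ _ snd fst (K `\ (section_ m x).2) _ (conj Knp ne).
Qed.

Let m_orientation m : mbor setT (fun x => orientation x (section_ m x)).
Proof.
have mfst : measurable_fun setT (fun x => (section_ m x).2.1).
  by apply: (measurableT_comp measurable_fst); exact: m_section2.
apply: (@mbor_ext _ X _ (fun x => edge_dom m x /\ exists n, [/\
    S (g n x, (section_ m x).2.1),
    forall j, j < n -> ~ S (g j x, (section_ m x).2.1) &
    exists p, g p x = (section_ m x).2.1 /\ exists N, linked m N n p x])) => [x _|].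
  split=> [[Dm [n [Sn nmin [p [gp /linkedP H]]]]]|[fm [n [Sn nmin] H]]].
    split; first exact: section_fiber.
    by exists n; [split|rewrite /towards -gp].
  have /fiberE[Km Rx _] := fm; split=> //; exists n; split=> //.
  have [p gp] := g_onto (Rsym Rx).
  by exists p; split=> //; apply/linkedP; rewrite -gp.
apply: (mbor_and measurableT); first exact: (mbor_set measurableT (m_edge_dom m)).
apply: (mbor_ex measurableT) => n.
have mSn j : mbor setT (fun x => S (g j x, (section_ m x).2.1)).
  apply: (@mbor_comp _ _ _ _ _ (fun x => (g j x, (section_ m x).2.1))) => //.
  exact: measurable_fun_pair.
apply: (@mbor_ext _ X _ (fun x => S (g n x, (section_ m x).2.1) /\
  ((forall j, j < n -> ~ S (g j x, (section_ m x).2.1)) /\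
  exists p, g p x = (section_ m x).2.1 /\ exists N, linked m N n p x))) => [x _|].
  by split=> [[? []]|[? ? ?]].
apply: (mbor_and measurableT) => //; apply: (mbor_and measurableT).
  apply: (mbor_all measurableT) => j.
  apply: (mbor_imp measurableT); first exact: (mbor_const measurableT).
  exact: (mbor_not measurableT).
apply: (mbor_ex measurableT) => p; apply: (mbor_and measurableT).
  by apply: mbor_eq => //; exact: standard_coded sX.
by apply: (mbor_ex measurableT) => N.
Qed.

Let fieldbor (P : X * set E -> Prop) : Prop :=
  bor (@power_field F d X R E) (@power_field_borel F d X R E) P.

Let field_sigma : sigma_algebra (@power_field F d X R E) (@power_field_borel F d X R E).
Proof. exact: smallest_sigma_algebra. Qed.

Let fieldbor_ext P Q : (forall x u, u `<=` fiber E x -> (P (x, u) <-> Q (x, u))) ->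
  fieldbor P -> fieldbor Q.
Proof. by move=> PQ; apply: bor_ext => -[x u]; exact: PQ. Qed.

Let fieldbor_base (B : set X) : measurable B -> fieldbor (fun xu => B xu.1).
Proof. by move=> mB; apply: sub_sigma_algebra; left; exists B. Qed.

Let fieldbor_eval m : fieldbor (fun xu => edge_dom m xu.1 /\ xu.2 (section_ m xu.1)).
Proof.
apply: sub_sigma_algebra; right; exists (edge_dom m), (section_ m); split=> //.
split=> //; first exact: measurable_funTS.
by move=> x; apply: section_fiber.
Qed.

(** As the sections enumerate each fibre of E, finiteness of the set where u
differs from the orientation means that the sections numbered below some N
already meet all of it, which is a Borel condition on the values of u. *)
Lemma almost_class_borel : power_field_borel almost_class.
Proof.
have Ecoded : coded (X * X)%type.
  by apply: (@standard_coded F); exact: standard_borel_prod.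
pose mismatch m (xu : X * set E) := edge_dom m xu.1 /\
  ~ ((edge_dom m xu.1 /\ xu.2 (section_ m xu.1)) <-> orientation xu.1 (section_ m xu.1)).
pose fin (xu : X * set E) := exists N, forall m, mismatch m xu ->
  exists j, j < N /\ (section_ j xu.1).2 = (section_ m xu.1).2.
have sec2 i j x : (section_ i x).2 = (section_ j x).2 -> section_ i x = section_ j x.
  by rewrite /section_; case: (unpickle i) => [[? ?]|]; case: (unpickle j) => [[? ?]|] //= ->.
have mismatchP m xu : mismatch m xu ->
    (orientation xu.1 `+` xu.2) (section_ m xu.1).
  move=> [Dm nE]; have [H|H] := pselect (orientation xu.1 (section_ m xu.1)).
    by left; split=> // H'; apply: nE.
  by right; split=> //; apply: contrapT => H'; apply: nE; split=> // -[].
have -> : almost_class = @power_field F d X R E `&` [set xu | fin xu].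
  apply/seteqP; split=> -[x u] [/= uE fu]; split=> //=.
    have [l lE] : exists l : seq E, [set` l] = orientation x `+` u.
      by move/finite_seqP: fu => [l ->]; exists l.
    have [N HN] : exists N, forall e, e \in l -> fiber E x e ->
        exists j, j < N /\ section_ j x = e.
      elim: l {lE} => [|e l [N HN]]; first by exists 0.
      have [fe|nfe] := pselect (fiber E x e).
        have [j _ je] := section_onto fe; exists (maxn N j.+1) => e'.
        rewrite inE => /orP[/eqP -> _|el fe'].
          by exists j; rewrite leq_max leqnn orbT.
        by have [i [iN ie]] := HN e' el fe'; exists i; rewrite leq_max iN.
      exists N => e'; rewrite inE => /orP[/eqP ->//|]; exact: HN.
    exists N => m /= mm; have [|j [jN jm]] := HN (section_ m x) _ (section_fiber mm.1).
      suff : [set` l] (section_ m x) by [].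
      by rewrite lE; apply: (mismatchP m (x, u)).
    by exists j; rewrite jm.
  case: fu => N HN.
  apply: (@sub_finite_set _ _ ((section_ ^~ x) @` `I_N)); last first.
    by apply: finite_image; exact: finite_II.
  move=> e ue; have fe : fiber E x e by case: ue => -[]; [case|move=> /uE].
  have [m Dm me] := section_onto fe; subst e.
  have [|j [jN jm]] := HN m; last by exists j => //; exact: sec2.
  split=> //= -[H1 H2]; case: ue => -[H H'].
    by apply: H'; case: (H2 H).
  by apply: H'; apply: H1.
apply: (bor_ex field_sigma) => N; apply: (bor_all field_sigma) => m.
apply: (bor_imp field_sigma).
  apply: (bor_and field_sigma); first exact: fieldbor_base.
  apply: (bor_not field_sigma); apply: (bor_iff field_sigma); first exact: fieldbor_eval.
  apply: (@fieldbor_base [set x | orientation x (section_ m x)]).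
  by rewrite -mborT; exact: m_orientation.
apply: (@fieldbor_base [set x | exists j, j < N /\ (section_ j x).2 = (section_ m x).2]).
rewrite -mborT; apply: (mbor_ex measurableT) => j; apply: (mbor_and measurableT).
  exact: (mbor_const measurableT).
by apply: mbor_eq => //; exact: m_section2.
Qed.

Lemma almost_class_stable : stable_almost_equality_class almost_class.
Proof.
split; first exact: almost_class_borel.
- move=> x; exists (orientation x); first by move=> e [].
  by apply/seteqP; split=> u.
- move=> x y Rxy; apply/seteqP; split=> [_ [u Vu <-]|u Vu].
    exact: almost_class_act.
  exists (power_act y x u); first by apply: almost_class_act => //; exact: Rsym.
  have [/= uE _] := Vu; apply/seteqP; split=> -[x' k].
    move=> [/fiberE[/= Kk Rxk ->]] /power_actE; apply=> //; exact: Rsym.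
  move=> uk; have /fiberE[/= Kk Rxk x'x] := uE _ uk; subst x'.
  split; first exact: uE.
  by apply/power_actE => //; exact: Rsym.
Qed.


Context (e : X -> Baire).
Hypotheses (me : measurable_fun setT e) (e_inj : injective e).

Definition sink_over x (u : set E) z : Prop :=
  R (z, x) /\ sink snd fst K [set k | u (x, k)] z.

(* Comparing codes makes the choice independent of the enumeration over x, hence
equivariant. *)
Definition chosen_sink x (u : set E) z : Prop :=
  sink_over x u z /\ forall z', sink_over x u z' -> ~ lexN (e z') (e z).

Let conn_R x y : same_component snd fst K x y -> R (x, y).
Proof.
move=> xy; apply: (@conn_invariant _ _ snd fst K (fun z => R (x, z)) _ x y) => //.
by move=> k /KR[/= Rab _]; split=> H; [apply: Rtrans H (Rsym Rab)|apply: Rtrans H Rab].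
Qed.

Lemma chosen_sink_uniq x u z z' :
  chosen_sink x u z -> chosen_sink x u z' -> z = z'.
Proof.
move=> [sz zmin] [sz' zmin']; apply: contrapT => zz'.
have /lexN_total[] : e z <> e z' by move=> /e_inj.
  exact: zmin'.
exact: zmin.
Qed.

(** Following arrows produces a sink, and there are finitely many in each of the
finitely many S-classes, so the lexicographic minimum exists. *)
Lemma chosen_sink_ex x u : A x -> almost_class (x, u) ->
  exists z, chosen_sink x u z.
Proof.
move=> Ax [/= uE /finite_seqP[l0 l0E]].
pose l := [seq k.2 | k : E <- l0].
have lP k : k \notin l -> (u (x, k) <-> orientation x (x, k)).
  move=> kl; have nl : ~ (orientation x `+` u) (x, k).
    rewrite l0E /= => kl0; case/negP: kl.
    by apply/mapP; exists ((x, k) : E).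
  have [Uk|nUk] := pselect (orientation x (x, k)); have [uk|nuk] := pselect (u (x, k)).
  - by [].
  - by case: nl; left.
  - by case: nl; right.
  - by [].
have AR y : R (y, x) -> A y by move=> /iA; apply.
have sinkP z n : R (z, x) -> rep x z n -> forall k, K k ->
    same_component snd fst K (g n x) k.1 -> k \notin l ->
    ([set k | u (x, k)] k <-> towardsK (g n x) k).
  move=> Rzx nz k Kk ck kl; have Rxk := Rtrans (Rsym (gR n x)) (conn_R ck).
  have Sk : S (g n x, k.1).
    by apply/connK => //; [apply: AR|apply: AR; exact: Rsym].
  rewrite /mkset lP // (@orientationP x k n) //.
  by apply: (rep_cong _ nz); apply: Strans (Ssym nz.1) Sk.
have [n nx] := rep_ex (Rrefl x).
have [w vw sw] := sink_exists acK (sinkP x n (Rrefl x) nx).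
have sxw : sink_over x u w.
  by split=> //; apply: Rtrans (gR n x); apply: Rsym; apply: conn_R.
have /choose_fun[rp Hrp] : forall z, exists n, R (z, x) -> rep x z n.
  move=> z; have [/rep_ex[m mz]|nR] := pselect (R (z, x)); first by exists m.
  by exists 0.
have [zs Hzs] := finS Ax.
(* Sinks are representatives or ends of the edges where u differs from the
orientation. *)
pose L := [seq g (rp z) x | z <- zs] ++ ([seq k.1 | k <- l] ++ [seq k.2 | k <- l]).
have HL y : sink_over x u y -> y \in L.
  move=> [Ryx sy]; have [z zzs Syz] := Hzs y Ryx.
  have Rzx : R (z, x).
    by apply: (Rtrans _ Ryx); apply: SR (AR _ Ryx) (Ssym Syz).
  have nz := Hrp z Rzx.
  have cy : same_component snd fst K (g (rp z) x) y.
    by apply/connK; [apply: AR|apply: AR|apply: Strans nz.1 (Ssym Syz)].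
  rewrite !mem_cat; have [->|[k kl [->|->]]] := sink_cases acK (sinkP z _ Rzx nz) cy sy.
  - by rewrite map_f.
  - by rewrite (map_f snd) // !orbT.
  - by rewrite (map_f fst) // orbT.
have [|y [_ sy] ymin] := @finite_minimal X (fun y z => lexN (e y) (e z)) (sink_over x u) L
  (fun _ => @lexN_irr _) (fun _ _ _ => @lexN_trans _ _ _).
  by exists w => //; exact: HL.
by exists y; split=> // z' sz'; apply: ymin => //; exact: HL.
Qed.

Lemma chosen_sink_act x y u z : R (x, y) -> u `<=` fiber E y ->
  (chosen_sink x (power_act x y u) z <-> chosen_sink y u z).
Proof.
move=> Rxy uE.
have sE z' : sink_over x (power_act x y u) z' <-> sink_over y u z'.
  rewrite /sink_over; have -> : [set k | power_act x y u (x, k)] = [set k | u (y, k)].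
    by apply/seteqP; split=> k /(power_actE k Rxy uE).
  by split=> -[Rz ?]; split=> //; apply: Rtrans Rz _ => //; exact: Rsym.
by split=> -[/sE sz zmin]; split=> // z' /sE; exact: zmin.
Qed.

Let fieldbor_sink n : fieldbor (fun xu => sink_over xu.1 xu.2 (g n xu.1)).
Proof.
pose P (xu : X * set E) m := edge_dom m xu.1 -> 
  ((section_ m xu.1).2.1 = g n xu.1 -> edge_dom m xu.1 /\ xu.2 (section_ m xu.1)) /\
  ((section_ m xu.1).2.2 = g n xu.1 -> ~ (edge_dom m xu.1 /\ xu.2 (section_ m xu.1))).
have secE m x : (x, (section_ m x).2) = section_ m x.
  by rewrite /section_; case: (unpickle m) => [[]|].
apply: (@fieldbor_ext (fun xu => forall m, P xu m)) => [x u uE|].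
  split=> [H|[_ sg] m Dm /=]; last first.
    have [s1 s2] := sg _ Dm; rewrite /mkset secE in s1 s2.
    by split=> E0; [split=> //; apply: s1|move=> [_]; apply: s2].
  split=> // k Kk; have [Rk _] := KR Kk.
  have sec : k.1 = g n x \/ k.2 = g n x -> exists2 m, edge_dom m x & section_ m x = (x, k).
    move=> kg; apply: section_onto; apply/fiberE; split=> //=.
    case: kg => kg; first by rewrite kg; exact: Rsym.
    by apply: Rtrans (Rsym (gR n x)) _; rewrite -kg; exact: Rsym.
  split=> kg; have [m Dm mk] := sec ltac:(tauto); have := H m Dm; rewrite /= mk /=.
    by move=> [/(_ kg)[]].
  by move=> [_ /(_ kg)]; tauto.
apply: (bor_all field_sigma) => m; apply: (bor_imp field_sigma).
  exact: fieldbor_base.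
have sec_eq (f : X -> X) : measurable_fun setT f ->
    fieldbor (fun xu => f xu.1 = g n xu.1).
  move=> mf; apply: (@fieldbor_base [set x | f x = g n x]).
  by rewrite -mborT; apply: mbor_eq => //; exact: standard_coded sX.
apply: (bor_and field_sigma); apply: (bor_imp field_sigma).
- apply: (sec_eq (fun x => (section_ m x).2.1)).
  by apply: (measurableT_comp measurable_fst); exact: m_section2.
- exact: fieldbor_eval.
- apply: (sec_eq (fun x => (section_ m x).2.2)).
  by apply: (measurableT_comp measurable_snd); exact: m_section2.
- by apply: (bor_not field_sigma); exact: fieldbor_eval.
Qed.

Let fieldbor_chosen n : fieldbor (fun xu => chosen_sink xu.1 xu.2 (g n xu.1)).
Proof.
apply: (@fieldbor_ext (fun xu => sink_over xu.1 xu.2 (g n xu.1) /\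
    forall m, sink_over xu.1 xu.2 (g m xu.1) ->
      ~ lexN (e (g m xu.1)) (e (g n xu.1)))) => [x u _|].
  split=> -[sn nmin]; split=> //; last by move=> m; exact: nmin.
  by move=> z' sz'; have [m zm] := g_onto sz'.1; subst z'; exact: nmin.
apply: (bor_and field_sigma); first exact: fieldbor_sink.
apply: (bor_all field_sigma) => m; apply: (bor_imp field_sigma).
  exact: fieldbor_sink.
apply: (bor_not field_sigma).
apply: (@fieldbor_base [set x | lexN (e (g m x)) (e (g n x))]).
have mc j i k : mbor setT (fun x => (e \o g j) x i = k).
  by apply: mbor_coord => //; exact: measurableT_comp.
rewrite -mborT; apply: (@mbor_ext _ X _ (fun x => exists i,
    (forall j, j < i -> exists k, (e \o g m) x j = k /\ (e \o g n) x j = k) /\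
    exists p q, p < q /\ ((e \o g m) x i = p /\ (e \o g n) x i = q))) => [x _|].
  split=> [[i [agr [p [q [pq [ip iq]]]]]]|[i agr lti]].
    exists i; last by rewrite /= in ip iq; rewrite ip iq.
    by move=> j /agr[k [/= -> <-]].
  exists i; split; last by exists (e (g m x) i), (e (g n x) i).
  by move=> j /agr ji; exists (e (g m x) j); rewrite /= ji.
apply: (mbor_ex measurableT) => i; apply: (mbor_and measurableT).
  apply: (mbor_all measurableT) => j.
  apply: (mbor_imp measurableT); first exact: (mbor_const measurableT).
  by apply: (mbor_ex measurableT) => k; apply: (mbor_and measurableT).
apply: (mbor_ex measurableT) => p; apply: (mbor_ex measurableT) => q.
apply: (mbor_and measurableT); first exact: (mbor_const measurableT).
exact: (mbor_and measurableT).
Qed.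

Section VertexPoint.
Context (A1 : set X) (T : rtree F R A1).
Hypotheses (mA : measurable A) (mA1 : measurable A1).

Local Notation VT := (vertices T).

(** The least sink of the subset of E that a vertex stands for. In particular the
vertices form a quasi-periodic set, the vertices v with pi v = proj v being a
fundamental domain. *)
Lemma vertex_point : is_vertex_set almost_class T -> exists pi : VT -> X,
  [/\ measurable_fun (@over _ _ _ _ _ (A `&` A1) T) pi,
      forall v, over (A `&` A1) v -> R (pi v, proj VT v) &
      forall x v, over (A `&` A1) v -> R (x, proj VT v) ->
        pi (act VT x v) = pi v].
Proof.
move=> [phi [phi_bij phi_act phi_borel]].
have phiV v : over (A `&` A1) v -> almost_class (proj VT v, phi v).
  by move=> [Cv [_ A1v]]; have [+ _ _] := phi_bij _ A1v; apply.
have /choose_fun[pi Hpi] : forall v, exists z, over (A `&` A1) v ->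
    chosen_sink (proj VT v) (phi v) z.
  move=> v; have [Ov|nO] := pselect (over (A `&` A1) v); last by exists point.
  have [|z Hz] := @chosen_sink_ex (proj VT v) (phi v) _ (phiV v Ov).
    by case: Ov => _ [].
  by exists z.
have piR v : over (A `&` A1) v -> R (pi v, proj VT v).
  by move=> /Hpi[[]].
exists pi; split=> //; last first.
  move=> x v Ov Rx.
  have Ox : over (A `&` A1) (act VT x v).
    have [Cv [Av A1v]] := Ov; split; first exact: act_carrier.
    rewrite /preimage /= act_proj //; split; first exact: iA Rx Av.
    by have := proj_base (act_carrier Cv Rx); rewrite act_proj.
  have Cv : carrier VT v by case: Ov.
  apply: chosen_sink_uniq (Hpi _ Ox) _.
  rewrite act_proj // phi_act //; apply/chosen_sink_act => //; last exact: Hpi.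
  by case: (phiV v Ov).
move=> mD B mB.
pose W n : set VT := @over _ _ _ _ _ (A `&` A1) T `&`
  [set v | chosen_sink (proj VT v) (phi v) (g n (proj VT v)) /\ B (g n (proj VT v))].
have -> : @over _ _ _ _ _ (A `&` A1) T `&` pi @^-1` B = \bigcup_n W n.
  apply/seteqP; split=> v.
    move=> [Ov Bv]; have [n pn] := g_onto (piR v Ov).
    exists n => //; split=> //; rewrite /mkset -pn; split=> //; exact: Hpi.
  move=> [n _ [Ov [cn Bn]]]; split=> //.
  by rewrite /preimage /= (chosen_sink_uniq (Hpi v Ov) cn).
apply: bigcupT_measurable => n; apply/(phi_borel (W n)).
  by move=> v [[]].
have -> : [set (proj VT v, phi v) | v in W n] = @power_field F d X R E `&`
    [set xu | almost_class xu /\ ((A `&` A1) xu.1 /\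
      (chosen_sink xu.1 xu.2 (g n xu.1) /\ B (g n xu.1)))].
  apply/seteqP; split=> [_ [v [Ov [cn Bn]] <-]|[x u] [/= uE [Vxu [[Ax A1x] [cn Bn]]]]].
    have Vv := phiV v Ov; split; first by case: Vv.
    by split=> //; split=> //; case: Ov.
  have [_ _ /(_ u Vxu)[v [Cv pv] vu]] := phi_bij x A1x.
  exists v; last by rewrite pv vu.
  split; last by rewrite /mkset pv vu.
  by split=> //; rewrite /preimage /= pv.
apply: (bor_and field_sigma).
  rewrite /bor; suff -> : @power_field F d X R E `&` [set xu | almost_class xu] = almost_class.
    exact: almost_class_borel.
  by apply/seteqP; split=> [xu []//|xu Vxu]; split=> //; case: Vxu.
apply: (bor_and field_sigma).
  by apply: (@fieldbor_base (A `&` A1)); exact: measurableI.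
apply: (bor_and field_sigma); first exact: fieldbor_chosen.
apply: (@fieldbor_base (g n @^-1` B)).
by rewrite -[X in measurable X]setTI; exact: mg.
Qed.

End VertexPoint.

End AlmostClass.

(** * Treeability from a finite index subrelation *)

Lemma acyclic_of_classes d (X : measurableType d) (S K : set (X * X)) :
  borel_equiv_rel S -> K `<=` S ->
  (forall k, K k -> acyclic_graph snd fst
     (K `&` (eclass S k.1 `*` eclass S k.1))) ->
  acyclic_graph snd fst K.
Proof.
move=> [_ [Srefl Ssym Strans]] KS acK v [//|[[a b] c] p] wp.
have Kab : K (a, b) by case: wp.
have Sab := KS _ Kab.
have walkS q u w : S (u, a) -> walk snd fst K u q w ->
    walk snd fst (K `&` (eclass S a `*` eclass S a)) u q w.
  elim: q u => //= -[[a' b'] c'] q IH u Sua [Kab' su wq].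
  have Sab' := KS _ Kab'; rewrite /step_start /step_end /= in su wq *.
  have Sb'a : S (b', a).
    have : S ((if c' then b' else a'), a) by rewrite su.
    by case: (c') => // Sa'a; apply: Strans (Ssym _ _ Sab') Sa'a.
  have Sa'a := Strans _ _ _ Sab' Sb'a.
  by split=> //; apply: IH wq; case: ifP.
apply: (acK _ Kab v); apply: walkS (wp).
move: wp => /= [_ <- _]; rewrite /step_start /=; case: ifP => _; [exact: Ssym|].
exact: Srefl.
Qed.

Lemma pmp_sub (F : realType) d (X : measurableType d) (mu : probability X F)
    (R R' : set (X * X)) :
  borel_equiv_rel R' -> R' `<=` R -> pmp mu R -> pmp mu R'.
Proof.
move=> bR' R'R [_ H]; split=> // K mK KR'; apply: H => //.
exact: subset_trans KR' R'R.
Qed.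

(** Where h n x falls outside the class of x it is replaced with x, which makes
the enumeration consist of total functions. *)
Lemma class_enumeration (F : realType) d (X : measurableType d) (R : set (X * X)) :
  standard_borel F X -> borel_equiv_rel R ->
  (forall x, countable (eclass R x)) ->
  exists g : nat -> X -> X, [/\ forall n, measurable_fun setT (g n),
    forall n x, R (g n x, x) & forall x y, R (y, x) -> exists n, y = g n x].
Proof.
move=> sX [mR [Rrefl Rsym _]] cR; have cX := standard_coded sX.
have [//|h [mh Hh]] := lusin_novikov cX cX mR.
  move=> x; apply: sub_countable (cR x); apply: subset_card_le => y.
  exact: Rsym.
have /choose_fun[g Hg] : forall n, exists g : X -> X, [/\ measurable_fun setT g,
    forall x, R (g x, x) & forall x, R (h n x, x) -> g x = h n x].
  move=> n; pose D j : set X := if j is 0 then [set x | R (h n x, x)] else setT.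
  have [||g mg Hg] := @first_choice _ _ X X D (fun j => if j is 0 then h n else id).
  - move=> [|j] //=; rewrite -mborT.
    apply: (@mbor_comp _ _ _ _ setT (fun x => (h n x, x))) => //.
    by apply: measurable_fun_pair => //; exact: measurable_id.
  - by move=> [|j] /=; [exact: measurable_funTS|exact: measurable_id].
  have DT : \bigcup_j D j = setT by apply/seteqP; split=> // x _; exists 1.
  exists g; split; first by rewrite -DT.
    move=> x; have [|[|j] [Dx -> _]] := Hg x; first by exists 1.
      exact: Dx.
    exact: Rrefl.
  move=> x Rx; have [|[|j] [_ -> H]] := Hg x; first by exists 1.
    by [].
  by case: (H 0 isT Rx).
exists g; split=> [n|n x|x y Ryx].
- by case: (Hg n).
- by case: (Hg n) => _ + _; apply.
have [n yn] := Hh _ _ (Rsym _ _ Ryx); exists n.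
by case: (Hg n) => _ _ ->; rewrite -yn.
Qed.

Theorem corollary1p3 (F : realType) :
  almost_stability F ->
  forall (d : measure_display) (X : measurableType d) (mu : probability X F)
    (R : set (X * X)),
  standard_borel F X -> pmp mu R ->
  admits_finite_index_treeable mu R -> treeable mu R.
Proof.
move=> AS d X mu R sX pR [A [[mA muA iA] [S [bS SR fiS [K [mK KSA connK treeK]]]]]].
have [bR _] := pR; have [mR [Rrefl Rsym Rtrans]] := bR.
have [mS [Srefl Ssym Strans]] := bS.
(* Off A, where nothing is known about the classes, R is made trivial. *)
pose R0 : set (X * X) := [set xy | (R xy /\ (A xy.1 /\ A xy.2)) \/ xy.1 = xy.2].
have R0R : R0 `<=` R by move=> [x y] [[]|/= ->].
have bR0 : borel_equiv_rel R0.
  split; last first.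
    split=> [x|x y [[/= ? [? ?]]|/= ->]|x y z [[/= ? [? ?]]|/= ->//]]; first by right.
    - by left; split=> //; exact: Rsym.
    - by right.
    - move=> [[/= ? [? ?]]|/= <-]; left; split=> //.
      by apply: Rtrans; eassumption.
  rewrite -mborT; apply: (mbor_or measurableT).
    apply: (mbor_and measurableT); first exact: (mbor_set measurableT mR).
    by apply: (mbor_and measurableT); apply: mbor_comp mA.
  by apply: mbor_eq => //; exact: standard_coded sX.
have R0A x y : A x -> (R0 (x, y) <-> R (x, y)).
  move=> Ax; split=> [/R0R//|Rxy]; left; split=> //; split=> //=.
  by apply: iA (Rsym _ _ Rxy) Ax.
have iA0 : invariant R0 A by move=> x y /R0R; exact: iA.
have finS x : A x -> exists l : seq X, (forall z, z \in l -> A z) /\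
    forall y, R0 (y, x) -> exists2 z, z \in l & S (y, z).
  move=> Ax; have [m [B [mB _ BA /(_ _)Bn]]] := fiS.
  have [j _ Bx] : (\bigcup_j B j) x by rewrite BA.
  have [n [f [_ fB fS]]] := Bn j; have [_ fE] := fS x Bx.
  exists [seq f i x | i <- enum 'I_n]; split.
    by move=> _ /mapP[i _ ->]; rewrite -BA; exists j => //; exact: fB.
  move=> y /R0R Ryx; have [i _ Si] : (\bigcup_i eclass S (f i x)) y by rewrite fE.
  by exists (f i x) => //; apply/mapP; exists i; rewrite ?mem_enum.
have cR0 x : countable (eclass R0 x).
  have [Ax|nAx] := pselect (A x); last first.
    apply: (@sub_countable _ _ _ [set x]) => //; apply: subset_card_le => y.
    by move=> [[_ [_ /=]]|].
  have [l [lA Hl]] := finS x Ax.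
  apply: (@sub_countable _ _ _ (\bigcup_(z in [set` l]) eclass S z)).
    by apply: subset_card_le => y /Hl[z zl Syz]; exists z.
  apply: bigcup_countable; first exact: finite_set_countable.
  by move=> z /= zl; have [[]] := treeK z (lA z zl).
have [g [mg gR g_onto]] := class_enumeration sX bR0 cR0.
have SR0 x y : A y -> S (x, y) -> R0 (x, y).
  by move=> Ay /SR Rxy; left; split=> //; split=> //; exact: iA Rxy Ay.
have finS' x : A x -> exists l : seq X,
    forall y, R0 (y, x) -> exists2 z, z \in l & S (y, z).
  by move=> /finS[l [_ Hl]]; exists l.
have acK : acyclic_graph snd fst K.
  apply: (acyclic_of_classes bS) => [k /KSA[]//|k Kk].
  by have [_ _] := treeK k.1 (KSA _ Kk).2.1.
pose E := edge_space sX bR0 mK.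
have cE : countable_rset E := edge_space_countable sX bR0 SR0 mK KSA g_onto.
have qE : quasi_periodic E := edge_space_quasi_periodic sX bR0 mK.
have sV := almost_class_stable sX bR0 iA0 bS SR0 mK KSA connK finS' mg gR g_onto.
have [A1 [[mA1 muA1 iA1] [T [vT _]]]] :=
  AS d X mu R0 sX (pmp_sub bR0 R0R pR) E cE qE _ sV.
have [e [c [me _ ec]]] := standard_coded sX.
have [pi [mpi piR pi_act]] := vertex_point iA0 bS SR0 KSA connK acK finS' mg gR
  g_onto me (can_inj ec) mA mA1 vT.
pose A' := A `&` A1.
have mA' : measurable A' by exact: measurableI.
have iA0' : invariant R0 A'.
  by move=> x y Rxy [Ay A1y]; split; [exact: iA0 Rxy Ay|exact: iA1 Rxy A1y].
have [K' [mK' KR' connK' treeK']] := treeing_of_rtree sX bR0 mA' iA0'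
  (@subIsetr _ _ _) (fun x _ => cR0 x) mpi piR pi_act.
exists A'; split.
  split=> //.
    by rewrite setCI; apply: null_set_setU => //; exact: measurableC.
  by move=> x y Rxy [Ay A1y]; apply: iA0' (conj Ay A1y); apply/R0A => //;
    exact: iA Rxy Ay.
exists K'; split=> //.
- by move=> k /KR'[/R0R].
- by move=> x y A'x A'y; rewrite connK' //; apply: R0A; case: A'x.
- move=> x A'x; have -> : eclass R x = eclass R0 x.
    apply/seteqP; split=> y; last exact: R0R.
    by move=> Ryx; apply/R0A => //; apply: iA Ryx _; case: A'x.
  exact: treeK'.
Qed.
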